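(* The extreme points of $$B=\big\{(\mu,\nu)\in M^+(\mathbb T)\times M^+(\mathbb T):\ \overline W_1(\mu,\nu)+\mu(\mathbb T)+\nu(\mathbb T)\le1,\ \mu(\mathbb T)=\nu(\mathbb T)\big\}$$ are exactly the pair $(0,0)$ and the pairs of rescaled Dirac deltas $\Big(\frac{\delta_x}{2+d_{\mathbb T}(x,\bar x)},\frac{\delta_{\bar x}}{2+d_{\mathbb T}(x,\bar x)}\Big)$ with $(x,\bar x)\in\mathbb T\times\mathbb T$.
   Context: $\mathbb T$ is the one-dimensional torus with its canonical (geodesic) metric $d_{\mathbb T}$, and $M^+(\mathbb T)$ is the set of positive finite Radon measures on $\mathbb T$. For $\mu,\nu\in M^+(\mathbb T)$ with $\mu(\mathbb T)=\nu(\mathbb T)=c>0$, $\overline W_1(\mu,\nu)=c\,W_1(\mu/c,\nu/c)$, where $W_1(\omega,\tau)=\inf\int_{\mathbb T\times\mathbb T}d_{\mathbb T}(x,y)\,d\gamma(x,y)$ over couplings $\gamma$ of the probability measures $\omega,\tau$; and $\overline W_1(0,0)=0$. *)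

(* Defs.v *)
From HB Require Import structures.
From mathcomp Require Import all_boot all_order all_algebra.
From mathcomp Require Import archimedean ring_quotient generic_quotient.
From mathcomp Require Import all_classical all_reals all_analysis.
From mathcomp Require Import ring.

Set Implicit Arguments.
Unset Strict Implicit.
Unset Printing Implicit Defensive.

Import Order.TTheory GRing.Theory Num.Theory.
Import numFieldNormedType.Exports.

Local Open Scope classical_set_scope.
Local Open Scope ring_scope.
Local Open Scope quotient_scope.

Definition period {R : realType} (L x : R) : bool :=
  `[< exists k : int, x = k%:~R * L >].

Lemma periodP (R : realType) (L x : R) :
  reflect (exists k : int, x = k%:~R * L) (x \in period L).
Proof. exact: asboolP. Qed.

Lemma period_zmod_closed (R : realType) (L : R) : zmod_closed (period L).
Proof.
split; first by apply/periodP; exists 0; rewrite mul0r.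
move=> x y /periodP[k ->] /periodP[l ->]; apply/periodP; exists (k - l).
by rewrite intrB mulrBl.
Qed.

HB.instance Definition _ (R : realType) (L : R) :=
  GRing.isZmodClosed.Build R (period L) (period_zmod_closed L).

(* The torus is R / LZ; its circumference L (say 1 or 2 * pi) is a parameter.
   Only L > 0 is meaningful, but the metric structure exists for every L. *)
Definition torus {R : realType} (L : R) : Type :=
  Quotient.quot (GRing.ZmodClosed.clone R (period L) _).

HB.instance Definition _ (R : realType) (L : R) :=
  EqQuotient.on (torus L).
HB.instance Definition _ (R : realType) (L : R) :=
  GRing.Zmodule.on (torus L).
HB.instance Definition _ (R : realType) (L : R) :=
  isPointed.Build (torus L) 0.

Section torus_metric.
Context {R : realType} (L : R).
Implicit Types (a b : R) (x y z : torus L).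

Local Notation pi := (\pi_(torus L)).

Definition torus_dist x y : R :=
  inf [set `|a - b| | a in [set a | pi a = x] & b in [set b | pi b = y]].

Lemma torus_piE a b : pi a = pi b <-> exists k : int, a - b = k%:~R * L.
Proof.
have E : (a - b \in period L) = (pi a == pi b).
  exact: (Quotient.idealrBE (GRing.ZmodClosed.clone R (period L) _)).
split=> [/eqP|/periodP]; rewrite -?E; first by move/periodP.
by rewrite E => /eqP.
Qed.

Let D x y := [set `|a - b| | a in [set a | pi a = x] & b in [set b | pi b = y]].

Let D_neq0 x y : D x y !=set0.
Proof.
by exists `|repr x - repr y|; exists (repr x); rewrite /= ?reprK//;
  exists (repr y); rewrite /= ?reprK.
Qed.

Let D_lb x y : lbound (D x y) 0.
Proof. by move=> _ [a _ [b _ <-]]. Qed.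

Let D_has_inf x y : has_inf (D x y).
Proof. by split; [exact: D_neq0|exists 0; exact: D_lb]. Qed.

Lemma torus_dist_ge0 x y : 0 <= torus_dist x y.
Proof. by apply: lb_le_inf; [exact: D_neq0|exact: D_lb]. Qed.

Lemma torus_dist_le a b : torus_dist (pi a) (pi b) <= `|a - b|.
Proof. by apply: ge_inf; [exists 0; exact: D_lb|exists a => //; exists b]. Qed.

Lemma torus_distxx x : torus_dist x x = 0.
Proof.
apply/eqP; rewrite eq_le torus_dist_ge0 andbT -(reprK x).
by rewrite (le_trans (torus_dist_le _ _))// subrr normr0.
Qed.

Lemma torus_dist_sym x y : torus_dist x y = torus_dist y x.
Proof.
rewrite /torus_dist; congr inf; apply/seteqP; split=> _ [a ax [b bx <-]];
by exists b => //; exists a => //; rewrite distrC.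
Qed.

Lemma torus_dist_triangle y x z :
  torus_dist x z <= torus_dist x y + torus_dist y z.
Proof.
rewrite -lerBlDr; apply: lb_le_inf; first exact: D_neq0.
move=> _ [a ax [b bx <-]]; rewrite lerBlDr addrC -lerBlDr.
apply: lb_le_inf; first exact: D_neq0.
move=> _ [b' b'x [c cx <-]]; rewrite lerBlDr.
have [k bb'] : exists k : int, b - b' = k%:~R * L.
  by apply/torus_piE; rewrite bx b'x.
have -> : z = pi (c + (b - b')).
  by rewrite -cx; apply/torus_piE; exists (- k); rewrite bb' opprD addNKr mulrNz mulNr.
rewrite -ax (le_trans (torus_dist_le _ _))//.
rewrite (_ : _ - _ = (b' - c) + (a - b)) ?ler_normD//.
by ring.
Qed.

Lemma torus_dist_eq0 x y : torus_dist x y = 0 -> x = y.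
Proof.
move=> xy0.
have H e : 0 < e -> exists a b, [/\ pi a = x, pi b = y & `|a - b| < e].
  move=> e0; have [_ [a ax [b bx <-]]] := inf_adherent e0 (D_has_inf x y).
  by rewrite -/(torus_dist x y) xy0 add0r => abe; exists a, b.
have [L0|L0] := eqVneq L 0.
  apply: contrapT => xNy.
  have piI a b : pi a = pi b -> a = b.
    by move/torus_piE => [k]; rewrite L0 mulr0 => /eqP; rewrite subr_eq0 => /eqP.
  have ne : 0 < `|repr x - repr y|.
    rewrite normr_gt0 subr_eq0; apply/eqP => e; apply: xNy.
    by rewrite -(reprK x) e reprK.
  have [a [b [ax bx]]] := H _ ne.
  have -> : a = repr x by apply: piI; rewrite ax reprK.
  have -> : b = repr y by apply: piI; rewrite bx reprK.
  by rewrite ltxx.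
have L2 : 0 < `|L| / 2 by rewrite divr_gt0// normr_gt0.
have [a [b [ax bx ab]]] := H _ L2.
have [ab0|ab0] := eqVneq a b; first by rewrite -ax -bx ab0.
have abgt : 0 < `|a - b| by rewrite normr_gt0 subr_eq0.
have [a' [b' [a'x b'x a'b']]] := H _ abgt.
have [k Ek] : exists k : int, a - a' = k%:~R * L by apply/torus_piE; rewrite ax a'x.
have [l El] : exists l : int, b - b' = l%:~R * L by apply/torus_piE; rewrite bx b'x.
have E : (a - b) - (a' - b') = (k - l)%:~R * L.
  by rewrite intrB mulrBl -Ek -El; ring.
have : `|(k - l)%:~R * L| < `|L|.
  by rewrite -E (le_lt_trans (ler_normB _ _))// (splitr `|L|) ltrD// (lt_trans a'b').
rewrite normrM gtr_pMl ?normr_gt0// -intr_norm -[1]/(1%:~R) ltr_int.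
rewrite -[X in _ < X]add0r ltzD1 normr_le0 subr_eq0 => /eqP kl.
move: E; rewrite kl subrr mul0r => /eqP; rewrite subr_eq0 => /eqP E.
by rewrite E ltxx in a'b'.
Qed.

HB.instance Definition _ := isMetric.Build R (torus L)
  torus_distxx torus_dist_eq0 torus_dist_sym torus_dist_triangle.

End torus_metric.

HB.instance Definition _ (R : realType) (L : R) :=
  @isMeasurable.Build (sigma_display (@open (torus L))) (torus L)
    <<s @open (torus L) >> (@sigma_algebra0 _ setT _) (@sigma_algebraC _ _)
    (@sigma_algebra_bigcup _ setT _).

Local Open Scope ereal_scope.

(* MathComp-Analysis measures are functions on all subsets, only constrained on
   measurable ones, so they are compared on measurable sets. *)
Definition eq_measure d (T : measurableType d) (R : realType)
    (mu nu : set T -> \bar R) : Prop :=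
  forall A, measurable A -> mu A = nu A.

Notation "mu =m nu" := (eq_measure mu nu) (at level 70, no associativity).

Section wasserstein_ball.
Context {R : realType} (L : R).
Local Notation T := (torus L).

Definition radon : set {finite_measure set T -> \bar R} :=
  [set mu : {finite_measure set T -> \bar R} | forall A : set T, measurable A ->
    mu A = ereal_sup [set mu K | K in [set K : set T | compact K /\ K `<=` A]]].

Definition couplings (omega tau : probability T R) :
    set (probability (T * T)%type R) :=
  [set gamma : probability (T * T)%type R |
    pushforward gamma fst =m omega /\ pushforward gamma snd =m tau].

Definition W1 (omega tau : probability T R) : \bar R :=
  ereal_inf [set \int[gamma]_z (mdist z.1 z.2)%:E
            | gamma in couplings omega tau].

(* For 0 < mu setT < +oo, mnormalize mu _ is mu / mu setT; its second argument
   is a default value for the other cases. This is only meant for mu and nu of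
   equal mass. *)
Definition W1bar (mu nu : {finite_measure set T -> \bar R}) : \bar R :=
  if mu setT == 0 then 0
  else mu setT * W1 (mnormalize mu (dirac (0%R : T)))
                    (mnormalize nu (dirac (0%R : T))).

Definition B :
    set ({finite_measure set T -> \bar R} * {finite_measure set T -> \bar R}) :=
  [set p | [/\ radon p.1, radon p.2,
     W1bar p.1 p.2 + p.1 setT + p.2 setT <= 1 & p.1 setT = p.2 setT]].

(* Extreme points of a set K of pairs of finite measures, seen in the vector
   space of pairs of finite signed measures. *)
Definition extreme_point
    (K : set ({finite_measure set T -> \bar R} *
              {finite_measure set T -> \bar R}))
    (p : {finite_measure set T -> \bar R} * {finite_measure set T -> \bar R}) :=
  K p /\
  forall q r (t : R), K q -> K r -> (0 < t < 1)%R ->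
    p.1 =m (fun A => t%:E * q.1 A + (1 - t)%:E * r.1 A) ->
    p.2 =m (fun A => t%:E * q.2 A + (1 - t)%:E * r.2 A) ->
    q.1 =m r.1 /\ q.2 =m r.2.

End wasserstein_ball.

Arguments B {R} L.

(* Main.v *)
Require Import Defs.
From HB Require Import structures.
From mathcomp Require Import all_boot all_order all_algebra.
From mathcomp Require Import all_classical all_reals all_analysis.
From mathcomp Require Import lra.

(** Write F(mu, nu) for the sum of the transport cost of (mu, nu) and of the two
masses. F is positively homogeneous and the ball is F <= 1, so a nonzero extreme
point has F = 1, and it admits no decomposition mu = mu1 + mu2, nu = nu1 + nu2
with F(mu1, nu1) + F(mu2, nu2) <= 1 unless (mu1, nu1) and (mu2, nu2) are
proportional: otherwise dividing each piece by its weight exhibits the pair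
inside a segment of the ball ([extreme_split]).

Cutting transport plans produces such decompositions. Let A be a Borel set and
let a plan between mu and nu of cost at most s be cut along A x T. The pieces
have costs adding up to at most s, the first marginal of one piece vanishes off
A and that of the other one vanishes on A. Proportional pieces are then
impossible unless one of them is zero, so A is null or conull for mu. Cutting
along T x A gives the same for nu. Thus both measures take only the values 0
and c, and on a metric space which is covered by finitely many small balls this
makes them multiples of Dirac masses ([zero_one_dirac]). The unique plan
between c delta_x and c delta_y costs c d(x, y), hence c = 1 / (2 + d(x, y)).

The argument cuts an exact minimiser, whose existence is a compactness
statement. It is replaced by [transport_split], which cuts a sequence of almost
optimal plans g_n and passes to the limit along an ultrafilter. The numbers
N(C, D) = lim g_n(C x D) are not at once the values of a measure on the
square, but they are dominated by the marginals: N(C, D) <= mu(C) and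
N(C, D) <= nu(D). A finitely additive function dominated by a finite measure is
countably additive ([dominated_additive_measure]), so N is a measure in each
variable. For every finite partition of the torus into small sets Q_i there is
a genuine plan which agrees with N on the rectangles C x Q_i
([bimeasure_glue]), and its cost is close to the limit of the costs of the g_n
([limit_plan]); this is all that is needed since the transport cost is an
infimum.

Conversely, if a pair of Dirac masses is decomposed inside the ball, both pieces
are concentrated at the same two points, with masses at most
1 / (2 + d(x, y)), so these masses are equal ([extreme_dirac]). *)

Set Implicit Arguments.
Unset Strict Implicit.

Import Order.TTheory GRing.Theory Num.Theory.
Import numFieldNormedType.Exports.
Import measurable_realfun.

Local Open Scope classical_set_scope.
Local Open Scope ring_scope.
Local Open Scope ereal_scope.

(** * Dominated set functions and finite partitions *)

(** Limits along an ultrafilter spare the extraction of subsequences: one choice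
of U makes all bounded quantities attached to a sequence of plans converge. *)
Lemma ultra_bounded_cvg (R : realType) (U : set_system nat) (u : nat -> R)
    (a b : R) : UltraFilter U -> (forall n, (a <= u n <= b)%R) ->
  exists2 l, (a <= l <= b)%R & u n @[n --> U] --> l.
Proof.
move=> UU uab.
have UF := @ultra_proper _ _ UU.
have [V [VU uV]] := @ultraFilterLemma _ (u @ U) _.
have : compact (`[a, b]%classic : set R) by exact: segment_compact.
rewrite compact_ultra => /(_ V VU).
have Vab : V `[a, b]%classic.
  have UI : U (u @^-1` `[a, b]%classic).
    by apply: filterS filterT => n _; rewrite /= in_itv/=; exact: uab.
  exact: uV.
move=> /(_ Vab)[l [/= labl Vl]].
exists l; first by move: labl; rewrite in_itv.
move=> A Al.
(* otherwise u avoids the neighbourhood A of l, although V --> l and V is finer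
   than u @ U *)
have [//|UNA] := @in_ultra_setVsetC _ U (u @^-1` A) UU.
have VF := @ultra_proper _ _ VU.
have VNA : V (~` A) by apply: uV.
have : V set0 by rewrite -(setICr A); apply: filterI => //; exact: Vl.
by move/filter_ex => [].
Qed.

Section dominated.
Context d (T : measurableType d) (R : realType).

(** For disjoint F_i with union F, the error f(F) - \sum_(i < n) f(F_i) is the
value of f on the tail F minus F_0, ..., F_(n-1), hence at most the value of mu
on that tail, which tends to 0. *)
Lemma dominated_additive_measure (mu : {finite_measure set T -> \bar R})
    (f : set T -> R) :
  (forall A, measurable A -> (0 <= f A <= fine (mu A))%R) ->
  (forall A B, measurable A -> measurable B -> A `&` B = set0 ->
     f (A `|` B) = (f A + f B)%R) ->
  exists eta : {finite_measure set T -> \bar R},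
    forall A, measurable A -> eta A = (f A)%:E.
Proof.
move=> f0 fD.
(* a measure has to be nonnegative on all sets, while f is only controlled on
   the measurable ones *)
pose eta A := if pselect (measurable A) then (f A)%:E else 0.
have etaE A : measurable A -> eta A = (f A)%:E.
  by move=> mA; rewrite /eta; case: pselect.
have fin A : measurable A -> mu A \is a fin_num by move=> mA; exact: fin_num_measure.
have f00 : f set0 = 0%R.
  by have := f0 _ measurable0; rewrite measure0/= => /le_anti.
have eta0 : eta set0 = 0 by rewrite etaE// f00.
have eta_ge0 A : 0 <= eta A.
  by rewrite /eta; case: pselect => // mA; rewrite lee_fin; case/andP: (f0 _ mA).
have fsum (F : (set T)^nat) n : (forall i, measurable (F i)) -> trivIset setT F ->
    f (\big[setU/set0]_(i < n) F i) = (\sum_(i < n) f (F i))%R.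
  move=> mF tF; elim: n => [|n ih]; first by rewrite !big_ord0.
  rewrite !big_ord_recr/= fD ?ih//; first exact: bigsetU_measurable.
  rewrite -bigcup_mkord setI_bigcupl bigcup0// => i /= im.
  by move/trivIsetP : tF => /(_ i n I I); apply; rewrite ltn_eqF.
have sigma : semi_sigma_additive eta.
  move=> F mF tF mUF.
  have mun : \sum_(0 <= i < n) mu (F i) @[n --> \oo] -->
      (fine (mu (\bigcup_i F i)))%:E.
    by rewrite fineK; [exact: measure_semi_sigma_additive|exact: fin].
  have mrest n : measurable (\bigcup_i F i `\` \big[setU/set0]_(i < n) F i).
    by apply: measurableD => //; exact: bigsetU_measurable.
  have sub n : \big[setU/set0]_(i < n) F i `<=` \bigcup_i F i.
    by rewrite -bigcup_mkord; apply: bigcup_sub => i _; exact: bigcup_sup.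
  have split n : f (\bigcup_i F i) =
      (\sum_(i < n) f (F i) + f (\bigcup_i F i `\` \big[setU/set0]_(i < n) F i))%R.
    rewrite -fsum// -fD ?setDUK//; first exact: bigsetU_measurable.
    exact: setDIK.
  (* the middle term is f of the tail, the right one is mu of the tail *)
  have bound n : (0 <= f (\bigcup_i F i) - \sum_(i < n) f (F i) <=
      fine (mu (\bigcup_i F i)) - \sum_(i < n) fine (mu (F i)))%R.
    rewrite (split n) addrAC subrr add0r.
    have /andP[-> /=] := f0 _ (mrest n).
    move=> /le_trans; apply.
    rewrite lerBrDr.
    rewrite -lee_fin EFinD -sumEFin !fineK//;
      [|exact: (fin _ mUF)|exact: (fin _ (mrest n))].
    rewrite -{2}(setDUK (sub n)) addeC measureU//; last 2 first.
      by apply: bigsetU_measurable.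
      exact: setDIK.
    rewrite measure_semi_additive_ord//; last 2 first.
    - by apply/trivIsetP => i j _ _ ij; move/trivIsetP : tF; apply.
    - exact: bigsetU_measurable.
    rewrite leeD2r//; apply: lee_sum => i _; rewrite fineK//; exact: fin.
  have rsum : (\sum_(i < n) fine (mu (F i)))%R @[n --> \oo] -->
      fine (mu (\bigcup_i F i)).
    have [_] := (fine_cvgP _ _).1 mun.
    apply: cvg_trans; apply: near_eq_cvg; apply: nearW => k /=.
    rewrite big_mkord sum_fine// => i _; exact: fin.
  rewrite etaE//.
  rewrite [X in X @ _ --> _](_ : _ = fun n => (\sum_(i < n) f (F i))%:E); last first.
    by apply/funext => n; rewrite big_mkord -sumEFin; apply: eq_bigr => i _; rewrite etaE.
  apply: cvg_EFin; first exact: nearW.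
  apply: (@squeeze_cvgr _ _ _ _
    (fun n => f (\bigcup_i F i) - (fine (mu (\bigcup_i F i)) - \sum_(i < n) fine (mu (F i))))%R
    (fun=> f (\bigcup_i F i))).
  - by apply: nearW => n; have := bound n; rewrite /comp/=; lra.
  - rewrite -[X in _ --> X]subr0; apply: cvgB; first exact: cvg_cst.
    rewrite -[X in _ --> X](subrr (fine (mu (\bigcup_i F i)))).
    by apply: cvgB => //; exact: cvg_cst.
  - exact: cvg_cst.
pose m0 := isMeasure.Build _ _ _ eta eta0 eta_ge0 sigma.
pose m : {measure set T -> \bar R} := HB.pack eta m0.
have fm : fin_num_fun m by move=> A mA; rewrite /m/= etaE.
pose m1 := Measure_isFinite.Build _ _ _ m fm.
by exists (HB.pack_for {finite_measure set T -> \bar R} eta m0 m1).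
Qed.
End dominated.

Lemma measure_finite_partition d (S : measurableType d) (R : realType)
    (m : {measure set S -> \bar R}) n (Q : 'I_n -> set S) (A : set S) :
  (forall i, measurable (Q i)) -> trivIset setT Q ->
  (forall x, exists i, Q i x) -> measurable A ->
  m A = \sum_(i < n) m (A `&` Q i).
Proof.
move=> mQ tQ cQ mA.
have E : A = \big[setU/set0]_(i < n) (A `&` Q i).
  apply/seteqP; split=> x.
    by move=> Ax; have [i Qi] := cQ x; rewrite (bigD1 i)//=; left.
  by rewrite -big_distrr/= => -[].
rewrite {1}E measure_semi_additive_ord//.
- by move=> i; exact: measurableI.
- by apply: trivIset_setIl.
- by apply: bigsetU_measurable => i _; exact: measurableI.
Qed.

Section integral_approx.
Context d (S : measurableType d) (R : realType).
Variable m : {measure set S -> \bar R}.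

Lemma integral_finite_partition (I : finType) (Q : I -> set S) (f : S -> R) :
  (forall i, measurable (Q i)) -> trivIset setT Q ->
  (forall x, exists i, Q i x) ->
  measurable_fun setT f -> (forall x, (0 <= f x)%R) ->
  \int[m]_x (f x)%:E = \sum_i \int[m]_(x in Q i) (f x)%:E.
Proof.
move=> mQ tQ cQ mf f0.
have QT : \big[setU/set0]_(i <- enum I) Q i = setT.
  by apply/seteqP; split => // x _; have [i Qi] := cQ x;
    rewrite big_enum/= (bigD1 i)//=; left.
rewrite -QT ge0_integral_bigsetU ?enum_uniq//.
- by rewrite big_enum.
- exact: sub_trivIset tQ.
- by rewrite QT; exact/measurable_EFinP.
- by move=> x _; rewrite lee_fin.
Qed.

(** The integral of a function which is almost constant on the cells of a finite
partition only depends, up to eta times the total mass, on the measure of the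
cells. Two measures which agree on the cells have therefore almost the same
integral. *)
Lemma integral_approx (I : finType) (Q : I -> set S) (f : S -> R)
    (v : I -> R) (eta : R) :
  (forall i, measurable (Q i)) -> trivIset setT Q ->
  (forall x, exists i, Q i x) ->
  measurable_fun setT f -> (forall x, (0 <= f x)%R) ->
  (forall i, (0 <= v i)%R) -> (0 <= eta)%R ->
  (forall i x, Q i x -> (`|f x - v i| <= eta)%R) ->
  m setT \is a fin_num ->
  \int[m]_x (f x)%:E \is a fin_num /\
  (`|fine (\int[m]_x (f x)%:E) - \sum_i v i * fine (m (Q i))|
     <= eta * fine (m setT))%R.
Proof.
move=> mQ tQ cQ mf f0 v0 eta0 fv mfin.
have mT : m setT = \sum_i m (Q i).
  have I1 D : measurable D -> \int[m]_(x in D) (cst 1%R x)%:E = m D.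
    by move=> mD; rewrite -[RHS]mul1e -(integral_cst m mD).
  have := @integral_finite_partition I Q (cst 1%R) mQ tQ cQ (measurable_cst _)
    (fun=> ler01).
  by rewrite I1// => ->; apply: eq_bigr => i _; rewrite I1.
have Qfin i : m (Q i) \is a fin_num.
  rewrite ge0_fin_numE//; apply: (@le_lt_trans _ _ (m setT)).
    by apply: le_measure => //; rewrite inE.
  by rewrite ltey_eq mfin.
have hi i : \int[m]_(x in Q i) (f x)%:E <= ((v i + eta) * fine (m (Q i)))%:E.
  rewrite EFinM fineK// -integral_cst//; apply: ge0_le_integral => //.
  - by move=> x _; rewrite lee_fin.
  - exact/measurable_EFinP/measurable_funTS.
  - move=> x Qx; rewrite lee_fin; have := fv _ _ Qx.
    by rewrite ler_norml; lra.
have Ifin i : \int[m]_(x in Q i) (f x)%:E \is a fin_num.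
  rewrite ge0_fin_numE; first by rewrite (le_lt_trans (hi i))// ltry.
  by apply: integral_ge0 => x _; rewrite lee_fin.
have lo i : (v i * fine (m (Q i)))%:E <=
    \int[m]_(x in Q i) (f x)%:E + (eta * fine (m (Q i)))%:E.
  rewrite !EFinM fineK// -!integral_cst//.
  rewrite -ge0_integralD//.
  - apply: ge0_le_integral => //.
    + by move=> x _; rewrite lee_fin.
    + by apply: emeasurable_funD => //; exact/measurable_EFinP/measurable_funTS.
    + move=> x Qx; rewrite lee_fin; have := fv _ _ Qx.
      by rewrite ler_norml; lra.
  - by move=> x _; rewrite lee_fin.
  - exact/measurable_EFinP/measurable_funTS.
rewrite (integral_finite_partition mQ)// mT.
have -> : \sum_i \int[m]_(x in Q i) (f x)%:E =
    (\sum_i fine (\int[m]_(x in Q i) (f x)%:E))%:E.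
  by rewrite -sumEFin; apply: eq_bigr => i _; rewrite fineK.
have -> : \sum_i m (Q i) = (\sum_i fine (m (Q i)))%:E.
  by rewrite -sumEFin; apply: eq_bigr => i _; rewrite fineK.
split => //=.
rewrite mulr_sumr -sumrB.
apply: (le_trans (ler_norm_sum _ _ _)); apply: ler_sum => i _.
have := hi i; have := lo i.
rewrite -(fineK (Ifin i)) -EFinD !lee_fin ler_norml; lra.
Qed.

End integral_approx.

(** * The torus as a measurable metric space *)

Section torus_metric.
Context (R : realType) (L : R).
Local Notation T := (torus L).

Lemma torus_open_ball (p : T) (r : R) : open [set y | (mdist p y < r)%R].
Proof.
rewrite openE => y /= pyr; rewrite /interior.
apply/metricType_numDomainType.nbhs_mdistP; exists (r - mdist p y)%R.
  by rewrite /= subr_gt0.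
move=> z /= yz; apply: (le_lt_trans (metric_triangle _ y _)); lra.
Qed.

Lemma torus_open_measurable (A : set T) : open A -> measurable A.
Proof. exact: sub_sigma_algebra. Qed.

Lemma torus_closed_measurable (A : set T) : closed A -> measurable A.
Proof.
by move=> cA; rewrite -(setCK A); apply: measurableC;
  apply: torus_open_measurable; exact: closed_openC.
Qed.

Lemma torus_compact_measurable (A : set T) : compact A -> measurable A.
Proof.
move=> cA; apply: torus_closed_measurable; apply: compact_closed => //.
exact: metric_hausdorff.
Qed.

Lemma torus_measurable_set1 (x : T) : measurable [set x].
Proof. by apply: torus_compact_measurable; exact: compact_set1. Qed.

Lemma torus_measurable_mdistl (p : T) : measurable_fun setT (mdist p : T -> R).
Proof.
move=> mD; apply: (measurability _ (RGenInftyO.measurableE R)) => //.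
move=> _ [_ [x ->] <-]; rewrite setTI.
apply: torus_open_measurable.
rewrite (_ : _ @^-1` _ = [set y | (mdist p y < x)%R]); first exact: torus_open_ball.
by apply/seteqP; split => y /=; rewrite in_itv.
Qed.

End torus_metric.

Section torus_pos.
Context (R : realType) (L : R) (L_gt0 : (0 < L)%R).
Local Notation T := (torus L).

(** The n classes of the points k L / n are at distance less than L / n of
everything: a representative in [0, L[ lies right above one of them. *)
Lemma torus_net (e : R) : (0 < e)%R -> exists n (p : nat -> T),
  forall x, exists2 k, (k < n)%N & (mdist (p k) x < e)%R.
Proof.
move=> e0.
pose n := (Num.truncn (L / e)).+1.
have n0 : (0 < n%:R :> R)%R by rewrite ltr0n.
have Ln : (L / n%:R < e)%R.
  rewrite ltr_pdivrMr// -ltr_pdivrMl// mulrC.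
  exact: truncnS_gt.
exists n, (fun k => \pi_(torus L)%qT (k%:R * (L / n%:R))%R).
move=> x.
pose a := repr x.
pose b := (a - (Num.floor (a / L))%:~R * L)%R.
have pib : \pi_(torus L)%qT b = x.
  rewrite -(reprK x); apply/torus_piE; exists (- Num.floor (a / L))%R.
  by rewrite /b mulrNz mulNr addrAC subrr add0r.
have b0 : (0 <= b)%R.
  by rewrite subr_ge0 -ler_pdivlMr// floor_le.
have bL : (b < L)%R.
  have := floorD1_gt (a / L).
  by rewrite intrD ltr_pdivrMr// mulrDl mul1r /b; lra.
pose k := Num.truncn (b / (L / n%:R)).
have Ln0 : (0 < L / n%:R)%R by rewrite divr_gt0.
have /andP[k1 k2] : (k%:R <= b / (L / n%:R) < k.+1%:R)%R.
  by apply: truncn_itv; rewrite divr_ge0// ltW.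
exists k.
  rewrite -(ltr_nat R); apply: (le_lt_trans k1).
  by rewrite ltr_pdivrMr// mulrC divfK ?gt_eqF.
rewrite -pib /=; apply: (@le_lt_trans _ _ `|k%:R * (L / n%:R) - b|%R).
  exact: torus_dist_le.
move: k1 k2; rewrite ler_pdivlMr// ltr_pdivrMr// -natr1 mulrDl mul1r => k1 k2.
by rewrite ltr_norml; lra.
Qed.

Lemma torus_partition (e : R) : (0 < e)%R ->
  exists n (P : 'I_n -> set T) (p : 'I_n -> T),
  [/\ forall i, measurable (P i), trivIset setT P,
      forall x, exists i, P i x &
      forall i x, P i x -> (mdist (p i) x < e)%R].
Proof.
move=> e0; have [n [p cover]] := torus_net e0.
pose F k := [set y | (mdist (p k) y < e)%R].
exists n, (fun i => seqDU F i), (fun i => p i); split.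
- move=> i; apply: measurableD.
    by apply: torus_open_measurable; exact: torus_open_ball.
  apply: bigsetU_measurable => j _.
  by apply: torus_open_measurable; exact: torus_open_ball.
- apply/trivIsetP => i j _ _ ij.
  by have /trivIsetP := trivIset_seqDU F; apply.
- move=> x; have [k kn kx] := cover x.
  have : (\big[setU/set0]_(i < n) F i) x.
    by rewrite (bigD1 (Ordinal kn))//=; left.
  rewrite bigsetU_seqDU -bigcup_mkord => -[i /= im ix].
  by exists (Ordinal im).
- by move=> i x Fix; have := @subset_seqDU _ F i x Fix.
Qed.

(** The Borel structure of the square is generated by rectangles, so the
metric is approximated uniformly by finite sums of products of functions of
one variable. *)
Lemma torus_measurable_mdist :
  measurable_fun setT (fun z : T * T => mdist z.1 z.2 : R).
Proof.
have H (m : nat) : exists h : T * T -> R, measurable_fun setT h /\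
    forall z, (`|h z - mdist z.1 z.2| <= m.+1%:R^-1)%R.
  have [|n [P [p [mP tP cP Pp]]]] := @torus_partition m.+1%:R^-1.
    by rewrite invr_gt0.
  exists (fun z => \sum_(i < n) \1_(P i) z.1 * mdist (p i) z.2)%R; split.
    apply: measurable_sum => i; apply: measurable_funM.
      apply: measurableT_comp; last exact: measurable_fst.
      exact: measurable_indic.
    apply: measurableT_comp; last exact: measurable_snd.
    exact: torus_measurable_mdistl.
  move=> [x y] /=; have [i Pix] := cP x.
  rewrite (bigD1 i)//= big1 ?addr0; last first.
    move=> j ji; rewrite indicE memNset ?mul0r// => Pjx.
    move/trivIsetP : tP => /(_ j i I I ji).
    by apply/eqP/set0P; exists x.
  rewrite indicE mem_set// mul1r.
  have := Pp _ _ Pix; have := metric_triangle (p i) x y.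
  have := metric_triangle x (p i) y; rewrite (metric_sym x (p i)).
  move: (m.+1%:R^-1)%R (mdist (p i) x) (mdist x y) (mdist (p i) y) => a b c u.
  by move=> h1 h2 h3; rewrite ler_norml; apply/andP; split; lra.
have [h hP] := choice H.
apply: (@measurable_fun_cvg _ _ _ _ h); first by move=> m; exact: (hP m).1.
move=> z _; apply/cvgrPdist_le => e e0; near=> m.
rewrite distrC; apply: (le_trans ((hP m).2 z)).
apply: ltW; near: m; exact: near_infty_natSinv_lt (PosNum e0).
Unshelve. all: by end_near.
Qed.

End torus_pos.

(** * Bimeasures *)

Section bimeasure.
Context d1 d2 (X : measurableType d1) (Y : measurableType d2) (R : realType).
Variable N : set X -> set Y -> R.
Hypothesis Nl : forall D, measurable D -> exists a : {finite_measure set X -> \bar R},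
  forall C, measurable C -> a C = (N C D)%:E.
Hypothesis Nr : forall C, measurable C -> exists b : {finite_measure set Y -> \bar R},
  forall D, measurable D -> b D = (N C D)%:E.

Lemma bimeasure_ge0 C D : measurable C -> measurable D -> (0 <= N C D)%R.
Proof.
by move=> mC mD; have [a aE] := Nl mD; rewrite -lee_fin -aE.
Qed.

Lemma bimeasure_leT C D : measurable C -> measurable D -> (N C D <= N setT D)%R.
Proof.
move=> mC mD; have [a aE] := Nl mD; rewrite -lee_fin -!aE//.
by apply: le_measure => //; rewrite inE.
Qed.

Lemma bimeasure_set0 C : measurable C -> N C set0 = 0%R.
Proof.
move=> mC; have [b bE] := Nr mC; apply: EFin_inj.
by rewrite -bE// measure0.
Qed.

(** On the strip X x Q_i take the product of N(-, Q_i) and of the measure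
N(X, -) conditioned on Q_i. The conditioning is invisible on sets which are
unions of cells, whence the values on C x Y and C x Q_i, and the masses
N(X, Q_i) cancel in the second marginal. *)
Lemma bimeasure_glue n (Q : 'I_n -> set Y) :
  (forall i, measurable (Q i)) -> trivIset setT Q ->
  (forall x, exists i, Q i x) ->
  exists g : {measure set (X * Y)%type -> \bar R},
  [/\ forall C, measurable C -> g (C `*` setT) = (N C setT)%:E,
      forall D, measurable D -> g (setT `*` D) = (N setT D)%:E &
      forall C i, measurable C -> g (C `*` Q i) = (N C (Q i))%:E].
Proof.
move=> mQ tQ cQ.
have [a aE] := choice (fun i => Nl (mQ i)).
have [b bE] := Nr (@measurableT _ X).
have k0 i : (0 <= (N setT (Q i))^-1)%R by rewrite invr_ge0 bimeasure_ge0.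
pose k i : {nonneg R} := NngNum (k0 i).
pose gi i : {measure set (X * Y)%type -> \bar R} :=
  mscale (k i) (a i \x mrestr b (mQ i)).
(* [msum] takes a sequence of measures, so the family is extended by zero *)
pose g : {measure set (X * Y)%type -> \bar R} :=
  msum (fun j => oapp gi (mzero : {measure set (X * Y)%type -> \bar R})
    (insub j)) n.
have gE C D : measurable C -> measurable D -> g (C `*` D) =
    (\sum_(i < n) (N setT (Q i))^-1 * (N C (Q i) * N setT (D `&` Q i)))%:E.
  move=> mC mD; rewrite /g/= /msum -sumEFin; apply: eq_bigr => i _.
  rewrite valK/= /mscale/= product_measure1E// !EFinM.
  congr (_ * (_ * _)); first exact: aE.
  by apply: bE; exact: measurableI.
have addN C D : measurable C -> measurable D ->
    N C D = (\sum_(i < n) N C (D `&` Q i))%R.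
  move=> mC mD; have [c cE] := Nr mC; apply: EFin_inj.
  rewrite -cE// (measure_finite_partition c mQ)// -sumEFin.
  by apply: eq_bigr => i _; apply: cE; exact: measurableI.
(* when N setT (Q i) = 0 its inverse is 0, and the strip is null anyway since
   N C (Q i) <= N setT (Q i) *)
have gcell C D : measurable C -> measurable D ->
    (forall i, D `&` Q i = set0 \/ D `&` Q i = Q i) -> g (C `*` D) = (N C D)%:E.
  move=> mC mD DQ; rewrite gE// addN//; congr (_%:E); apply: eq_bigr => i _.
  have [->|->] := DQ i; first by rewrite !bimeasure_set0// !mulr0.
  have [N0|N0] := eqVneq (N setT (Q i)) 0%R; last by rewrite mulrCA mulVf// mulr1.
  have := bimeasure_ge0 mC (mQ i); have := bimeasure_leT mC (mQ i).
  by rewrite N0 => h1 h2; have/eqP <- : (0 == N C (Q i))%R; rewrite ?eq_le ?h1 ?h2 ?mulr0.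
exists g; split.
- by move=> C mC; apply: gcell => // i; right; rewrite setTI.
- move=> D mD; rewrite gE// addN//; congr (_%:E); apply: eq_bigr => i _.
  have mDQ : measurable (D `&` Q i) by exact: measurableI.
  have [N0|N0] := eqVneq (N setT (Q i)) 0%R; last by rewrite mulKf.
  rewrite N0 invr0 mul0r; apply/eqP; rewrite eq_le bimeasure_ge0//=.
  rewrite -N0 -!lee_fin -!bE//; apply: le_measure => //; rewrite ?inE//.
- move=> C i mC; apply: gcell => // j.
  have [->|ji] := eqVneq j i; first by right; rewrite setIid.
  by left; move/trivIsetP : tQ; apply => //; rewrite eq_sym.
Qed.
End bimeasure.

(** * Transport plans *)

Section transport.
Context (R : realType) (L : R).
Local Notation T := (torus L).

Definition plan (g : set (T * T) -> \bar R) (mu nu : set T -> \bar R) : Prop :=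
  (forall A, measurable A -> g (A `*` setT) = mu A) /\
  (forall A, measurable A -> g (setT `*` A) = nu A).

Definition cost (g : set (T * T) -> \bar R) : \bar R :=
  \int[g]_z (mdist z.1 z.2)%:E.

(** A bound on the infimum of the costs, phrased without a minimiser and without
normalising the masses, so that it is stable under scaling and limits. *)
Definition transport_le (mu nu : set T -> \bar R) (s : R) : Prop :=
  forall e : R, (0 < e)%R -> exists g : {measure set (T * T)%type -> \bar R},
    plan g mu nu /\ cost g <= (s + e)%:E.

Lemma cost_ge0 (g : {measure set (T * T)%type -> \bar R}) : 0 <= cost g.
Proof. by apply: integral_ge0 => z _; rewrite lee_fin mdist_ge0. Qed.

Lemma transport_le_ge0 mu nu s : transport_le mu nu s -> (0 <= s)%R.
Proof.
move=> H; apply/ler_addgt0Pr => e e0; have [g [_ gs]] := H e e0.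
by rewrite -lee_fin (le_trans (cost_ge0 g)).
Qed.

Lemma eq_cost (g h : {measure set (T * T)%type -> \bar R}) :
  (forall A, measurable A -> g A = h A) -> cost g = cost h.
Proof. by move=> gh; apply: eq_measure_integral => A mA _; exact: gh. Qed.

Hypothesis L_gt0 : (0 < L)%R.

Lemma measurable_cost :
  measurable_fun setT (fun z : T * T => (mdist z.1 z.2)%:E : \bar R).
Proof. by apply/measurable_EFinP; exact: torus_measurable_mdist. Qed.

Lemma cost_mscale (k : {nonneg R}) (g : {measure set (T * T)%type -> \bar R}) :
  cost (mscale k g) = k%:num%:E * cost g.
Proof.
rewrite /cost ge0_integral_mscale//; first exact: measurable_cost.
by move=> x _; rewrite lee_fin mdist_ge0.
Qed.

Lemma cost_add (g h k : {measure set (T * T)%type -> \bar R}) :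
  (forall A, measurable A -> k A = g A + h A) -> cost k = cost g + cost h.
Proof.
move=> kE; rewrite (@eq_cost k (measure_add g h)); last first.
  by move=> A mA; rewrite kE//; exact/esym/measure_addE.
rewrite /cost ge0_integral_measure_add//.
  by move=> x _; rewrite lee_fin mdist_ge0.
exact: measurable_cost.
Qed.

(** On a product of two sets contained in balls of radius e / 2 the distance
differs by at most e from the distance of the centres, so the cost of a plan is determined up to e times its mass by
the measure of finitely many rectangles; the same rectangles serve for all
plans. *)
Lemma cost_approx (e : R) : (0 < e)%R ->
  exists n (P : 'I_n -> set T) (p : 'I_n -> T),
  [/\ forall i, measurable (P i), trivIset setT P, forall x, exists i, P i x &
    forall g : {measure set (T * T)%type -> \bar R}, g setT \is a fin_num ->
    cost g \is a fin_num /\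
    (`|fine (cost g) - \sum_(q : 'I_n * 'I_n)
         mdist (p q.1) (p q.2) * fine (g (P q.1 `*` P q.2))|
       <= e * fine (g setT))%R].
Proof.
move=> e0.
have [|n [P [p [mP tP cP Pp]]]] := @torus_partition _ _ L_gt0 (e / 2)%R.
  by rewrite divr_gt0.
exists n, P, p; split=> // g gfin.
apply: (@integral_approx _ _ _ g _ (fun q : 'I_n * 'I_n => P q.1 `*` P q.2)
  (fun z => mdist z.1 z.2) (fun q => mdist (p q.1) (p q.2))) => //.
- by move=> q; exact: measurableX.
- apply/trivIsetP => -[i j] [i' j'] _ _ ij.
  apply/seteqP; split => // -[x y] [[/= Pix Pjy] [/= Pi'x Pj'y]].
  have ii' : i = i' by apply: tP => //; exists x.
  have jj' : j = j' by apply: tP => //; exists y.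
  by move: ij; rewrite ii' jj' eqxx.
- by move=> [x y]; have [i Pi] := cP x; have [j Pj] := cP y; exists (i, j).
- exact: torus_measurable_mdist.
- by move=> z; exact: mdist_ge0.
- by move=> q; exact: mdist_ge0.
- exact: ltW.
- move=> [i j] [x y] [/= Pix Pjy].
  have := metric_triangle x (p i) y; have := metric_triangle (p i) (p j) y.
  have := metric_triangle (p i) x (p j); have := metric_triangle x y (p j).
  rewrite (metric_sym x (p i)) (metric_sym y (p j)).
  have := Pp _ _ Pix; have := Pp _ _ Pjy.
  move: (mdist (p i) x) (mdist (p j) y) (mdist (p i) (p j)) (mdist x y)
    (mdist x (p j)) (mdist (p i) y) => a b c u v w.
  by move=> h1 h2 h3 h4 h5 h6; rewrite ler_norml; apply/andP; split; lra.
Qed.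
End transport.

(** * Limits of transport plans *)

Lemma cvg_sumr (R : realType) (U : set_system nat) (FU : ProperFilter U)
    (I : Type) (r : seq I) (f : I -> nat -> R) (l : I -> R) :
  (forall i, f i n @[n --> U] --> l i) ->
  (\sum_(i <- r) f i n)%R @[n --> U] --> (\sum_(i <- r) l i)%R.
Proof.
move=> fl; elim: r => [|i r ih].
  by rewrite big_nil; under eq_fun do rewrite big_nil; exact: cvg_cst.
by rewrite big_cons; under eq_fun do rewrite big_cons; exact: cvgD.
Qed.

Section limit_plan.
Context (R : realType) (L : R) (L_gt0 : (0 < L)%R).
Local Notation T := (torus L).
Variables (g : nat -> {measure set (T * T)%type -> \bar R}).
Variables (mu nu : {finite_measure set T -> \bar R}).
Hypothesis gmu : forall n A, measurable A -> g n (A `*` setT) <= mu A.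
Hypothesis gnu : forall n A, measurable A -> g n (setT `*` A) <= nu A.
Variables (U : set_system nat) (UU : UltraFilter U).

Let UF : ProperFilter U := @ultra_proper _ _ UU.
Local Existing Instance UF.

(** Only rectangles are recorded: there the limit is additive in each variable
and bounded by a marginal, which gives countable additivity. *)
Let N (C D : set T) : R := lim (fine (g n (C `*` D)) @[n --> U]).

Let g_le n C D C' D' : measurable C -> measurable D ->
  measurable C' -> measurable D' -> C `<=` C' -> D `<=` D' ->
  g n (C `*` D) <= g n (C' `*` D').
Proof.
move=> mC mD mC' mD' CC DD; apply: le_measure; rewrite ?inE.
- exact: measurableX.
- exact: measurableX.
- by move=> [x y] [/= /CC ? /DD].
Qed.

Let gT_fin n : g n setT \is a fin_num.
Proof.
rewrite -setXTT ge0_fin_numE//; apply: (le_lt_trans (gmu n measurableT)).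
by rewrite ltey_eq fin_num_measure.
Qed.

Let g_fin n C D : measurable C -> measurable D -> g n (C `*` D) \is a fin_num.
Proof.
move=> mC mD; rewrite ge0_fin_numE//.
apply: (@le_lt_trans _ _ (g n (setT `*` setT))); first exact: g_le.
by rewrite setXTT ltey_eq gT_fin.
Qed.

Let N_cvg C D : measurable C -> measurable D ->
  fine (g n (C `*` D)) @[n --> U] --> N C D.
Proof.
move=> mC mD.
have [|l _ gl] := @ultra_bounded_cvg R U (fun n => fine (g n (C `*` D)))
    0 (fine (mu setT)) UU.
  move=> n; rewrite fine_ge0//= fine_le ?fin_num_measure ?g_fin//.
  by apply: (le_trans _ (gmu n measurableT)); exact: g_le.
by rewrite /N (cvg_lim _ gl).
Qed.

Let N_ge0 C D : measurable C -> measurable D -> (0 <= N C D)%R.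
Proof.
move=> mC mD; apply: limr_ge; first by apply: cvgP; exact: N_cvg.
by apply: nearW => n; rewrite fine_ge0.
Qed.

Let N_lemu C D : measurable C -> measurable D -> (N C D <= fine (mu C))%R.
Proof.
move=> mC mD; apply: limr_le; first by apply: cvgP; exact: N_cvg.
apply: nearW => n; rewrite fine_le ?fin_num_measure ?g_fin//.
by apply: (le_trans _ (gmu n mC)); exact: g_le.
Qed.

Let N_lenu C D : measurable C -> measurable D -> (N C D <= fine (nu D))%R.
Proof.
move=> mC mD; apply: limr_le; first by apply: cvgP; exact: N_cvg.
apply: nearW => n; rewrite fine_le ?fin_num_measure ?g_fin//.
by apply: (le_trans _ (gnu n mD)); exact: g_le.
Qed.

Let NUl C C' D : measurable C -> measurable C' -> measurable D ->
  C `&` C' = set0 -> N (C `|` C') D = (N C D + N C' D)%R.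
Proof.
move=> mC mC' mD CC'; apply: cvg_lim => //.
rewrite (_ : (fun n => _) = fun n =>
  (fine (g n (C `*` D)) + fine (g n (C' `*` D)))%R); last first.
  apply/funext => n; rewrite -fineD ?g_fin// -measureU.
  - by congr (fine (g n _)); apply/seteqP; split => -[x y] /=; tauto.
  - exact: measurableX.
  - exact: measurableX.
  - by apply/seteqP; split => // -[x y] [[/= Cx _] [/= C'x _]];
      (have : (C `&` C') x by []); rewrite CC'.
by apply: cvgD; exact: N_cvg.
Qed.

Let NUr C D D' : measurable C -> measurable D -> measurable D' ->
  D `&` D' = set0 -> N C (D `|` D') = (N C D + N C D')%R.
Proof.
move=> mC mD mD' DD'; apply: cvg_lim => //.
rewrite (_ : (fun n => _) = fun n =>
  (fine (g n (C `*` D)) + fine (g n (C `*` D')))%R); last first.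
  apply/funext => n; rewrite -fineD ?g_fin// -measureU.
  - by congr (fine (g n _)); apply/seteqP; split => -[x y] /=; tauto.
  - exact: measurableX.
  - exact: measurableX.
  - by apply/seteqP; split => // -[x y] [[/= _ Dx] [/= _ D'x]];
      (have : (D `&` D') y by []); rewrite DD'.
by apply: cvgD; exact: N_cvg.
Qed.

Let Nl D : measurable D -> exists a : {finite_measure set T -> \bar R},
  forall C, measurable C -> a C = (N C D)%:E.
Proof.
move=> mD; apply: (@dominated_additive_measure _ _ _ mu (N^~ D)).
  by move=> C mC; rewrite N_ge0//= N_lemu.
by move=> C C' mC mC'; exact: NUl.
Qed.

Let Nr C : measurable C -> exists b : {finite_measure set T -> \bar R},
  forall D, measurable D -> b D = (N C D)%:E.
Proof.
move=> mC; apply: (@dominated_additive_measure _ _ _ nu (N C)).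
  by move=> D mD; rewrite N_ge0//= N_lenu.
by move=> D D' mD mD'; exact: NUr.
Qed.

(** Compactness of dominated plans, and lower semicontinuity of the transport
cost along their limits. For each precision the limit bimeasure is glued into a
plan with the limit marginals, a different plan for each precision. *)
Lemma limit_plan : exists mu1 nu1 : {finite_measure set T -> \bar R},
  [/\ forall A, measurable A -> mu1 A <= mu A,
      forall A, measurable A -> nu1 A <= nu A,
      forall A, measurable A ->
        fine (g n (A `*` setT)) @[n --> U] --> fine (mu1 A),
      forall A, measurable A ->
        fine (g n (setT `*` A)) @[n --> U] --> fine (nu1 A) &
      forall s : R, fine (cost (g n)) @[n --> U] --> s ->
        transport_le mu1 nu1 s].
Proof.
have [mu1 mu1E] := Nl measurableT; have [nu1 nu1E] := Nr measurableT.
exists mu1, nu1; split.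
- by move=> A mA; rewrite mu1E// -(fineK (fin_num_measure mu _ mA)) lee_fin N_lemu.
- by move=> A mA; rewrite nu1E// -(fineK (fin_num_measure nu _ mA)) lee_fin N_lenu.
- by move=> A mA; rewrite mu1E//; exact: N_cvg.
- by move=> A mA; rewrite nu1E//; exact: N_cvg.
move=> s gs e e0.
pose c := fine (mu setT).
have c0 : (0 <= c)%R by rewrite fine_ge0.
(* the costs are compared twice, for the glued plan and for g n, and each
   comparison loses eta * c *)
pose eta := (e / (2 * c + 1))%R.
have c1 : (0 < 2 * c + 1)%R by lra.
have eta0 : (0 < eta)%R by rewrite divr_gt0.
have etac : (2 * (eta * c) <= e)%R.
  have : (eta * (2 * c + 1) = e)%R by rewrite /eta divfK ?gt_eqF.
  by rewrite mulrDr; lra.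
have [n [P [p [mP tP cP Pcost]]]] := cost_approx L_gt0 eta0.
have [h [hmu hnu hP]] := bimeasure_glue Nl Nr mP tP cP.
exists h; split.
  by split=> A mA; [rewrite hmu// mu1E|rewrite hnu// nu1E].
have hT : h setT = (N setT setT)%:E by rewrite -setXTT hmu.
have [|hfin happ] := Pcost h; first by rewrite hT.
rewrite -(fineK hfin) lee_fin.
have S_le : (\sum_(q : 'I_n * 'I_n)
    mdist (p q.1) (p q.2) * fine (h (P q.1 `*` P q.2)) <= s + eta * c)%R.
  apply: (@ler_cvg_to _ U _ _ (fun m => \sum_(q : 'I_n * 'I_n)
      mdist (p q.1) (p q.2) * fine (g m (P q.1 `*` P q.2)))%R
      (fun m => fine (cost (g m)) + eta * c)%R).
  - apply: cvg_sumr => q; apply: cvgM; first exact: cvg_cst.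
    by rewrite hP//; exact: N_cvg.
  - by apply: cvgD => //; exact: cvg_cst.
  - apply: nearW => m; have [_] := Pcost _ (gT_fin m).
    have : (eta * fine (g m setT) <= eta * c)%R.
      rewrite ler_pM2l// fine_le ?fin_num_measure ?gT_fin//.
      by rewrite -{1}setXTT gmu.
    by rewrite ler_norml => + /andP[+ _]; lra.
have : (eta * fine (h setT) <= eta * c)%R by rewrite hT ler_pM2l//= N_lemu.
by move: happ; rewrite ler_norml => /andP[_]; lra.
Qed.

End limit_plan.

(** * The normalised Wasserstein distance *)

Lemma mnormalizeE d (S : measurableType d) (R : realType)
    (m : {measure set S -> \bar R}) (P : probability S R) (c : R) A :
  (0 < c)%R -> m setT = c%:E -> mnormalize m P A = m A * (c^-1)%:E.
Proof.
move=> c0 mc; rewrite /mnormalize mc/= ifF//.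
by rewrite orbF eqe gt_eqF.
Qed.

Section W1bar.
Context (R : realType) (L : R) (L_gt0 : (0 < L)%R).
Local Notation T := (torus L).

(** The plans between mu and nu of mass c are the multiples by c of the couplings
of the normalised measures, and their costs are scaled by c. *)
Lemma W1bar_leP (mu nu : {finite_measure set T -> \bar R}) (s : R) :
  0 < mu setT -> mu setT = nu setT ->
  (W1bar mu nu <= s%:E) <-> transport_le mu nu s.
Proof.
move=> mu0 munu.
pose c := fine (mu setT).
have muc : mu setT = c%:E by rewrite fineK// fin_num_measure.
have nuc : nu setT = c%:E by rewrite -munu.
have c0 : (0 < c)%R by rewrite -lte_fin -muc.
have E : W1bar mu nu = c%:E * W1 (mnormalize mu (dirac (0%R : T)))
                    (mnormalize nu (dirac (0%R : T))).
  by rewrite /W1bar gt_eqF// muc.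
rewrite E; split.
- move=> Ws e e0.
  have : W1 (mnormalize mu (dirac (0%R : T))) (mnormalize nu (dirac (0%R : T)))
      < ((s + e) / c)%:E.
    apply: (@le_lt_trans _ _ (s / c)%:E).
      by rewrite mulrC EFinM lee_pdivlMl.
    by rewrite lte_fin ltr_pM2r ?invr_gt0// ltrDl.
  move=> /ereal_inf_lt[_ [gam [g1 g2] <-] gse].
  pose k : {nonneg R} := NngNum (ltW c0).
  exists (mscale k gam); split.
    split=> A mA.
      transitivity (c%:E * mnormalize mu (dirac (0%R : T)) A).
        congr (_ * _); rewrite -(g1 A mA) /pushforward; congr (gam _).
        by apply/seteqP; split=> -[x y] //= [].
      rewrite (mnormalizeE _ _ c0 muc) muleCA -EFinM divff ?mule1//.
      by rewrite gt_eqF.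
    transitivity (c%:E * mnormalize nu (dirac (0%R : T)) A).
      congr (_ * _); rewrite -(g2 A mA) /pushforward; congr (gam _).
      by apply/seteqP; split=> -[x y] //= [].
    rewrite (mnormalizeE _ _ c0 nuc) muleCA -EFinM divff ?mule1//.
    by rewrite gt_eqF.
  rewrite cost_mscale//= -lee_pdivlMl// -EFinM mulrC; exact: ltW.
- move=> H; apply/lee_addgt0Pr => e e0.
  have [g [[g1 g2] gse]] := H e e0.
  have gc : g setT = c%:E by rewrite -setXTT g1.
  pose P : probability (T * T)%type R :=
    mnormalize g (dirac (0%R : T, 0%R : T)).
  have PE A : P A = g A * (c^-1)%:E by exact: mnormalizeE.
  rewrite -EFinD; apply: le_trans gse; rewrite -lee_pdivlMl//.
  have ci : (0 <= c^-1)%R by rewrite invr_ge0 ltW.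
  rewrite -[X in _ <= X%:E * _]/((NngNum ci)%:num) -cost_mscale//.
  rewrite (_ : cost _ = cost P); last first.
    by apply: eq_cost => A mA; apply: (etrans (muleC _ _)); exact/esym/PE.
  apply: ereal_inf_lbound; exists P => //; split=> A mA.
    apply: (etrans (PE _)); apply: (etrans _ (esym (mnormalizeE _ _ c0 muc))).
    congr (_ * _).
    by apply: (etrans _ (g1 _ mA)); congr (g _); apply/seteqP; split=> -[x y] //= [].
  apply: (etrans (PE _)); apply: (etrans _ (esym (mnormalizeE _ _ c0 nuc))).
    congr (_ * _).
  by apply: (etrans _ (g2 _ mA)); congr (g _); apply/seteqP; split=> -[x y] //= [].
Qed.

End W1bar.

(** * Membership in the ball *)

Section ball.
Context (R : realType) (L : R).
Local Notation T := (torus L).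

(** If K is almost all of A for m, then it is so for eta. This transfers inner
regularity to the pieces into which mu and nu are cut. *)
Lemma radon_le (m eta : {finite_measure set T -> \bar R}) (k : R) :
  (forall A, measurable A -> eta A <= k%:E * m A) -> radon m -> radon eta.
Proof.
move=> etam mR A mA; apply/eqP; rewrite eq_le; apply/andP; split; last first.
  apply: ge_ereal_sup => _ [K [cK KA] <-]; apply: le_measure; rewrite ?inE//.
  exact: torus_compact_measurable.
apply/lee_addgt0Pr => e e0.
(* |k| replaces k, and 1 is added to keep d defined when k = 0 *)
pose d := (e / (`|k| + 1))%R.
have k1 : (0 < `|k| + 1)%R by rewrite ltr_wpDl.
have d0 : (0 < d)%R by rewrite divr_gt0.
have : m A - d%:E < ereal_sup [set m K | K in [set K : set T | compact K /\ K `<=` A]].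
  by rewrite -mR// lteBlDr// lteDl ?lte_fin// fin_num_measure.
move=> /ereal_sup_gt[_ [K [cK KA] <-] Kd].
have mK := torus_compact_measurable cK.
have mAK : measurable (A `\` K) by exact: measurableD.
have dec (n : {finite_measure set T -> \bar R}) : n A = n K + n (A `\` K).
  by rewrite -measureU ?setDUK ?setDIK.
have AKd : m (A `\` K) <= d%:E.
  move: Kd; rewrite (dec m).
  rewrite -(fineK (fin_num_measure m _ mK)) -(fineK (fin_num_measure m _ mAK)).
  by rewrite -EFinD lte_fin !lee_fin; lra.
rewrite (dec eta) leeD//.
  by apply: ereal_sup_ubound; exists K.
apply: (le_trans (etam _ mAK)).
apply: (@le_trans _ _ (`|k|%:E * m (A `\` K))).
  by rewrite lee_wpmul2r// lee_fin ler_norm.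
apply: (@le_trans _ _ (`|k|%:E * d%:E)); first by rewrite lee_wpmul2l// lee_fin.
rewrite -EFinM lee_fin.
have : ((`|k| + 1) * d = e)%R by rewrite /d mulrC divfK ?gt_eqF.
by rewrite mulrDl mul1r; lra.
Qed.

Lemma radon_dirac (m : {finite_measure set T -> \bar R}) (k : R) (x : T) :
  m =m (fun A => k%:E * \d_x A) -> radon m.
Proof.
move=> mE A mA; apply/eqP; rewrite eq_le; apply/andP; split; last first.
  apply: ge_ereal_sup => _ [K [cK KA] <-]; apply: le_measure; rewrite ?inE//.
  exact: torus_compact_measurable.
have [Ax|Ax] := pselect (A x).
  apply: ereal_sup_ubound; exists [set x].
    by split; [exact: compact_set1|move=> _ ->].
  rewrite !mE//; last exact: torus_measurable_set1.
  by rewrite !diracE !mem_set.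
rewrite mE// diracE memNset// mule0; apply: ereal_sup_ubound; exists set0.
  by split; [exact: compact0|exact: sub0set].
by rewrite measure0.
Qed.

Lemma transport_leW (mu nu : set T -> \bar R) (s u : R) :
  (s <= u)%R -> transport_le mu nu s -> transport_le mu nu u.
Proof.
move=> su H e e0; have [g [gp gs]] := H e e0; exists g; split=> //.
by apply: (le_trans gs); rewrite lee_fin lerD2r.
Qed.

Hypothesis L_gt0 : (0 < L)%R.

Lemma transport_le_scale (mu nu : {measure set T -> \bar R}) (s : R)
    (k : {nonneg R}) : (0 < k%:num)%R -> transport_le mu nu s ->
  transport_le (mscale k mu) (mscale k nu) (k%:num * s)%R.
Proof.
move=> k0 H e e0.
have [|g [[g1 g2] gs]] := H (e / k%:num)%R; first by rewrite divr_gt0.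
exists (mscale k g); split.
  by split=> A mA; rewrite /mscale/=; congr (_ * _); [exact: g1|exact: g2].
rewrite cost_mscale//.
apply: (@le_trans _ _ (k%:num%:E * (s + e / k%:num)%:E)).
  by rewrite lee_wpmul2l// lee_fin ltW.
by rewrite -EFinM lee_fin mulrDr (mulrC _ (e / _)%R) divfK ?gt_eqF.
Qed.

Lemma B_transportP (mu nu : {finite_measure set T -> \bar R}) (c : R) : (0 < c)%R ->
  mu setT = c%:E ->
  B L (mu, nu) <-> [/\ radon mu, radon nu, nu setT = c%:E &
    transport_le mu nu (1 - 2 * c)].
Proof.
move=> c0 muc.
have H : W1bar mu nu + c%:E + c%:E <= 1 <-> W1bar mu nu <= (1 - 2 * c)%:E.
  rewrite -!leeBrDr// -!EFinB.
  by rewrite (_ : 1 - c - c = 1 - 2 * c)%R//; lra.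
split.
- move=> [/= rm rn W mn]; rewrite -mn muc; split=> //.
  apply/(W1bar_leP L_gt0) => //; first by rewrite muc.
  by apply/H; rewrite -muc {2}mn.
- move=> [rm rn nc W]; split=> //=; last by rewrite muc.
  rewrite muc nc; apply/H/(W1bar_leP L_gt0) => //; rewrite muc//.
Qed.

(** A plan between multiples of two Dirac masses charges neither the complement
of x on the first factor nor that of y on the second one, so all its mass sits
at (x, y). *)
Lemma transport_le_dirac (mu nu : set T -> \bar R) (a : R) (x y : T) (s : R) :
  (0 <= a)%R ->
  mu =m (fun A => a%:E * \d_x A) -> nu =m (fun A => a%:E * \d_y A) ->
  transport_le mu nu s <-> (a * mdist x y <= s)%R.
Proof.
move=> a0 muE nuE; split.
- move=> H; apply/ler_addgt0Pr => e e0; have [g [[g1 g2] gs]] := H e e0.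
  rewrite -lee_fin; apply: le_trans gs.
  have mx := torus_measurable_set1 x; have my := torus_measurable_set1 y.
  have mxC := measurableC mx; have myC := measurableC my.
  have gx : g (~` [set x] `*` setT) <= 0.
    by rewrite g1// muE// diracE memNset ?mule0// => /(_ erefl).
  have gy : g (setT `*` ~` [set y]) <= 0.
    by rewrite g2// nuE// diracE memNset ?mule0// => /(_ erefl).
  have mxy := measurableX mx my.
  have ga : a%:E <= g ([set x] `*` [set y]).
    have -> : a%:E = g setT by rewrite -setXTT g1// muE// diracT mule1.
    apply: (@le_trans _ _ (g ([set x] `*` [set y] `|`
        (~` [set x] `*` setT `|` setT `*` ~` [set y])))).
      apply: le_measure; rewrite ?inE//.
        by apply: measurableU => //; apply: measurableU; exact: measurableX.
      move=> [u v] _ /=.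
      have [ux|ux] := pselect (u = x); last by right; left.
      by have [vy|vy] := pselect (v = y); [left|right; right].
    apply: (le_trans (measureU2 _ _ _)) => //.
      by apply: measurableU; exact: measurableX.
    rewrite -[leRHS]adde0 leeD//.
    apply: (le_trans (measureU2 _ _ _)); [exact: measurableX|exact: measurableX|].
    by rewrite -[leRHS]adde0; apply: leeD; [exact: gx|exact: gy].
  apply: (@le_trans _ _ (\int[g]_(z in [set x] `*` [set y]) (mdist x y)%:E)).
    by rewrite integral_cst// muleC EFinM lee_wpmul2r// lee_fin mdist_ge0.
  rewrite /cost; apply: (@le_trans _ _
      (\int[g]_(z in [set x] `*` [set y]) (mdist z.1 z.2)%:E)).
    apply: ge0_le_integral => //.
    - by move=> z _; rewrite lee_fin mdist_ge0.
    - by apply: measurable_funTS; exact: measurable_cost.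
    - by move=> [u v] [/= -> ->].
  apply: ge0_subset_integral => //; first exact: measurable_cost.
  by move=> z _; rewrite lee_fin mdist_ge0.
- move=> H e e0; exists (mscale (NngNum a0) (dirac (x, y))); split.
    split=> A mA; rewrite /mscale/= ?muE ?nuE//; congr (_ * _); rewrite !diracE;
      congr ((_ (_ : bool))%:R%:E); apply/idP/idP; rewrite !inE => //=.
    + by case.
    + by case.
  rewrite cost_mscale// /cost integral_dirac//; last exact: measurable_cost.
  by rewrite diracT mul1e/= -EFinM lee_fin; lra.
Qed.

End ball.

(** * Cutting almost optimal plans *)

Section splitting.
Context (R : realType) (L : R) (L_gt0 : (0 < L)%R).
Local Notation T := (torus L).
Implicit Types mu nu : {finite_measure set T -> \bar R}.

(** Restrict almost optimal plans to E and to its complement and take limits of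
the two families. The four implications record where the marginals of the
pieces vanish when E is a strip. *)
Lemma transport_split mu nu (s : R) (E : set (T * T)) :
  transport_le mu nu s -> measurable E ->
  exists (mu1 nu1 mu2 nu2 : {finite_measure set T -> \bar R}) (s1 s2 : R),
  [/\ forall A, measurable A -> mu A = mu1 A + mu2 A /\ nu A = nu1 A + nu2 A,
      mu1 setT = nu1 setT /\ mu2 setT = nu2 setT,
      transport_le mu1 nu1 s1 /\ transport_le mu2 nu2 s2,
      (s1 + s2 <= s)%R &
      forall A, measurable A ->
      [/\ (A `*` setT) `&` E = set0 -> mu1 A = 0,
          (A `*` setT) `&` ~` E = set0 -> mu2 A = 0,
          (setT `*` A) `&` E = set0 -> nu1 A = 0 &
          (setT `*` A) `&` ~` E = set0 -> nu2 A = 0]].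
Proof.
move=> Hs mE; have mEC := measurableC mE.
have /choice[g gP] : forall n : nat, exists g : {measure set (T * T)%type -> \bar R},
    plan g mu nu /\ cost g <= (s + n.+1%:R^-1)%:E.
  by move=> n; apply: Hs; rewrite invr_gt0.
have [U [UU oU]] := @ultraFilterLemma _ (\oo : set_system nat) _.
have UF : ProperFilter U := @ultra_proper _ _ UU.
pose g1 n : {measure set (T * T)%type -> \bar R} := mrestr (g n) mE.
pose g2 n : {measure set (T * T)%type -> \bar R} := mrestr (g n) mEC.
have gT n : g n setT \is a fin_num.
  by rewrite -setXTT (gP n).1.1// fin_num_measure.
have g_fin n A : measurable A -> g n A \is a fin_num.
  move=> mA; rewrite ge0_fin_numE//; apply: (@le_lt_trans _ _ (g n setT)).
    by apply: le_measure => //; rewrite inE.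
  by rewrite ltey_eq gT.
have g12 n A : measurable A -> g n A = g1 n A + g2 n A.
  move=> mA; rewrite /g1 /g2/= /mrestr -measureU.
  - by rewrite -setIUr setUv setIT.
  - exact: measurableI.
  - exact: measurableI.
  - by rewrite setIACA setICr setI0.
have g1_fin n A : measurable A -> g1 n A \is a fin_num.
  by move=> mA; apply: g_fin; exact: measurableI.
have g2_fin n A : measurable A -> g2 n A \is a fin_num.
  by move=> mA; apply: g_fin; exact: measurableI.
have le1 n A : measurable A -> g1 n A <= g n A.
  by move=> mA; rewrite (g12 n A mA) leeDl.
have le2 n A : measurable A -> g2 n A <= g n A.
  by move=> mA; rewrite (g12 n A mA) leeDr.
have mX (A : set T) : measurable A -> measurable (A `*` [set: T]).
  by move=> mA; exact: measurableX.
have mX' (A : set T) : measurable A -> measurable ([set: T] `*` A).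
  by move=> mA; exact: measurableX.
have gmu n A : measurable A -> g n (A `*` setT) <= mu A.
  by move=> mA; rewrite (gP n).1.1.
have gnu n A : measurable A -> g n (setT `*` A) <= nu A.
  by move=> mA; rewrite (gP n).1.2.
have [mu1 [nu1 [_ _ cmu1 cnu1 tr1]]] := @limit_plan R L L_gt0 g1 mu nu
  (fun n A mA => le_trans (le1 n _ (mX A mA)) (gmu n A mA))
  (fun n A mA => le_trans (le1 n _ (mX' A mA)) (gnu n A mA))
  U UU.
have [mu2 [nu2 [_ _ cmu2 cnu2 tr2]]] := @limit_plan R L L_gt0 g2 mu nu
  (fun n A mA => le_trans (le2 n _ (mX A mA)) (gmu n A mA))
  (fun n A mA => le_trans (le2 n _ (mX' A mA)) (gnu n A mA))
  U UU.
have cost12 n : cost (g n) = cost (g1 n) + cost (g2 n).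
  by apply: cost_add => // A mA; exact: g12.
have cfin n : cost (g n) \is a fin_num.
  by rewrite ge0_fin_numE ?cost_ge0// (le_lt_trans (gP n).2)// ltry.
have c1le n : cost (g1 n) <= cost (g n) by rewrite cost12 leeDl// cost_ge0.
have c2le n : cost (g2 n) <= cost (g n) by rewrite cost12 leeDr// cost_ge0.
have c1fin n : cost (g1 n) \is a fin_num.
  rewrite ge0_fin_numE ?cost_ge0//; apply: (le_lt_trans (c1le n)).
  by rewrite ltey_eq cfin.
have c2fin n : cost (g2 n) \is a fin_num.
  rewrite ge0_fin_numE ?cost_ge0//; apply: (le_lt_trans (c2le n)).
  by rewrite ltey_eq cfin.
have csum n : (fine (cost (g1 n)) + fine (cost (g2 n)) <= s + n.+1%:R^-1)%R.
  by rewrite -lee_fin EFinD !fineK// -cost12; exact: (gP n).2.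
have c1ge n : (0 <= fine (cost (g1 n)))%R by rewrite fine_ge0// cost_ge0.
have c2ge n : (0 <= fine (cost (g2 n)))%R by rewrite fine_ge0// cost_ge0.
have inv1 n : (n.+1%:R^-1 <= 1 :> R)%R by rewrite invf_le1// ler1n.
have [|s1 _ s1P] := @ultra_bounded_cvg R U (fun n => fine (cost (g1 n))) 0 (s + 1) UU.
  by move=> n; have := csum n; have := c1ge n; have := c2ge n; have := inv1 n;
    move: (n.+1%:R^-1)%R => a; lra.
have [|s2 _ s2P] := @ultra_bounded_cvg R U (fun n => fine (cost (g2 n))) 0 (s + 1) UU.
  by move=> n; have := csum n; have := c1ge n; have := c2ge n; have := inv1 n;
    move: (n.+1%:R^-1)%R => a; lra.
have uniq (f : nat -> R) (a b : R) :
    f n @[n --> U] --> a -> f n @[n --> U] --> b -> a = b.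
  by move=> fa fb; exact: (cvg_unique _ fa fb).
have null (h : nat -> {measure set (T * T)%type -> \bar R})
    (m : {finite_measure set T -> \bar R})
    (A : set T) (B : set (T * T)) : measurable A ->
    fine (h n B) @[n --> U] --> fine (m A) -> (forall n, h n B = 0) -> m A = 0.
  move=> mA hm h0; rewrite -(fineK (fin_num_measure m _ mA)); congr (_%:E).
  apply: (uniq _ _ _ hm); rewrite (_ : (fun n => _) = fun=> 0%R).
    exact: cvg_cst.
  by apply/funext => n; rewrite h0.
have addlim (m m1 m2 : {finite_measure set T -> \bar R}) (A : set T) (B : set (T * T)) :
    measurable A -> measurable B -> (forall n, g n B = m A) ->
    fine (g1 n B) @[n --> U] --> fine (m1 A) ->
    fine (g2 n B) @[n --> U] --> fine (m2 A) -> m A = m1 A + m2 A.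
  move=> mA mB gm h1 h2.
  rewrite -(fineK (fin_num_measure m _ mA)) -(fineK (fin_num_measure m1 _ mA))
    -(fineK (fin_num_measure m2 _ mA)) -EFinD; congr (_%:E).
  apply: (uniq (fun=> fine (m A))); first exact: cvg_cst.
  rewrite (_ : (fun=> _) = fun n => (fine (g1 n B) + fine (g2 n B))%R).
    exact: cvgD.
  by apply/funext => n; rewrite -(gm n) -fineD ?g12// ?g1_fin ?g2_fin.
exists mu1, nu1, mu2, nu2, s1, s2; split.
- move=> A mA; split.
    by apply: (addlim _ _ _ A (A `*` setT)); [|exact: mX|move=> n; exact: (gP n).1.1
      |exact: cmu1|exact: cmu2].
  by apply: (addlim _ _ _ A (setT `*` A)); [|exact: mX'|move=> n; exact: (gP n).1.2
      |exact: cnu1|exact: cnu2].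
- have eqT (m m' : {finite_measure set T -> \bar R}) (f : nat -> R) :
      f n @[n --> U] --> fine (m setT) -> f n @[n --> U] --> fine (m' setT) ->
      m setT = m' setT.
    move=> h h'; rewrite -(fineK (fin_num_measure m _ measurableT)).
    by rewrite -(fineK (fin_num_measure m' _ measurableT)) (uniq _ _ _ h h').
  split; first exact: (eqT _ _ _ (cmu1 _ measurableT) (cnu1 _ measurableT)).
  exact: (eqT _ _ _ (cmu2 _ measurableT) (cnu2 _ measurableT)).
- by split; [exact: tr1|exact: tr2].
- apply/ler_addgt0Pr => e e0.
  apply: (@ler_cvg_to _ U _ _ (fun n => fine (cost (g1 n)) + fine (cost (g2 n)))%R
      (fun=> s + e)%R); [exact: cvgD|exact: cvg_cst|].
  apply: oU; near=> n; apply: (le_trans (csum n)); rewrite lerD2l ltW//.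
  by near: n; exact: near_infty_natSinv_lt (PosNum e0).
- move=> A mA; split=> AE.
  + by apply: (null g1 _ _ _ mA (cmu1 _ mA)) => n; rewrite /g1/= /mrestr AE measure0.
  + by apply: (null g2 _ _ _ mA (cmu2 _ mA)) => n; rewrite /g2/= /mrestr AE measure0.
  + by apply: (null g1 _ _ _ mA (cnu1 _ mA)) => n; rewrite /g1/= /mrestr AE measure0.
  + by apply: (null g2 _ _ _ mA (cnu2 _ mA)) => n; rewrite /g2/= /mrestr AE measure0.
Unshelve. all: by end_near.
Qed.

End splitting.

(** * Extreme points of the ball *)

Section extreme.
Context (R : realType) (L : R) (L_gt0 : (0 < L)%R).
Local Notation T := (torus L).
Implicit Types mu nu : {finite_measure set T -> \bar R}.

(** By homogeneity a piece of (mu, nu) can be scaled up to the boundary of the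
ball. *)
Lemma B_rescale mu nu mu1 nu1 (s a k : R) :
  radon mu -> radon nu ->
  (forall A, measurable A -> mu1 A <= mu A) ->
  (forall A, measurable A -> nu1 A <= nu A) ->
  (0 < a)%R -> mu1 setT = a%:E -> nu1 setT = a%:E -> transport_le mu1 nu1 s ->
  (0 < k)%R -> (k * (s + 2 * a) <= 1)%R ->
  exists q : {finite_measure set T -> \bar R} * {finite_measure set T -> \bar R},
    [/\ B L q, q.1 =m (fun A => k%:E * mu1 A) & q.2 =m (fun A => k%:E * nu1 A)].
Proof.
move=> rmu rnu lmu lnu a0 m1 n1 tr k0 ks.
pose kk : {nonneg R} := NngNum (ltW k0).
pose q1 : {finite_measure set T -> \bar R} := mscale kk mu1.
pose q2 : {finite_measure set T -> \bar R} := mscale kk nu1.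
exists (q1, q2); split => //.
have ka : (0 < k * a)%R by exact: mulr_gt0.
apply/(B_transportP L_gt0 q2 ka).
  by rewrite EFinM -m1.
split.
- apply: radon_le rmu => A mA; apply: (@lee_wpmul2l _ k%:E); last exact: lmu.
  by rewrite lee_fin ltW.
- apply: radon_le rnu => A mA; apply: (@lee_wpmul2l _ k%:E); last exact: lnu.
  by rewrite lee_fin ltW.
- by rewrite EFinM -n1.
apply: transport_leW (transport_le_scale L_gt0 (k := kk) _ tr) => //=.
lra.
Qed.

(** The pieces, divided by the weights t and 1 - t, are points of the ball of
which (mu, nu) is the barycentre. The choice t = s1 + 2 * a1 puts the first one
on the boundary, and s2 + 2 * a2 <= 1 - t keeps the second one inside. *)
Lemma extreme_split mu nu mu1 nu1 mu2 nu2 (s1 s2 a1 a2 : R) :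
  extreme_point (B L) (mu, nu) ->
  (forall A, measurable A -> mu A = mu1 A + mu2 A /\ nu A = nu1 A + nu2 A) ->
  mu1 setT = a1%:E -> nu1 setT = a1%:E -> mu2 setT = a2%:E -> nu2 setT = a2%:E ->
  (0 < a1)%R -> (0 < a2)%R ->
  transport_le mu1 nu1 s1 -> transport_le mu2 nu2 s2 ->
  (s1 + s2 + 2 * (a1 + a2) <= 1)%R ->
  exists k1 k2 : R, [/\ (0 < k1)%R, (0 < k2)%R,
    forall A, measurable A -> k1%:E * mu1 A = k2%:E * mu2 A &
    forall A, measurable A -> k1%:E * nu1 A = k2%:E * nu2 A].
Proof.
move=> [[rmu rnu _ _] ext] dec m1 n1 m2 n2 a1_gt0 a2_gt0 tr1 tr2 s12.
have s1_ge0 := transport_le_ge0 tr1; have s2_ge0 := transport_le_ge0 tr2.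
pose t := (s1 + 2 * a1)%R.
have t0 : (0 < t)%R by rewrite /t; lra.
have t1 : (0 < 1 - t)%R by rewrite /t; lra.
have tV : (0 < t^-1)%R by rewrite invr_gt0.
have t1V : (0 < (1 - t)^-1)%R by rewrite invr_gt0.
have [|||q [qB q1 q2]] :=
  @B_rescale mu nu mu1 nu1 s1 a1 t^-1 rmu rnu _ _ a1_gt0 m1 n1 tr1 tV.
- by move=> A mA; rewrite (dec A mA).1 leeDl.
- by move=> A mA; rewrite (dec A mA).2 leeDl.
- by rewrite mulVf// gt_eqF.
have [|||r [rB r1 r2]] :=
  @B_rescale mu nu mu2 nu2 s2 a2 (1 - t)^-1 rmu rnu _ _ a2_gt0 m2 n2 tr2 t1V.
- by move=> A mA; rewrite (dec A mA).1 leeDr.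
- by move=> A mA; rewrite (dec A mA).2 leeDr.
- by rewrite mulrC ler_pdivrMr// mul1r /t; lra.
have [|||qr1 qr2] := ext q r t qB rB.
- by rewrite t0 -subr_gt0.
- move=> A mA /=; rewrite q1// r1// !muleA -!EFinM !divff ?gt_eqF// !mul1e.
  exact: (dec A mA).1.
- move=> A mA /=; rewrite q2// r2// !muleA -!EFinM !divff ?gt_eqF// !mul1e.
  exact: (dec A mA).2.
exists t^-1%R, (1 - t)^-1%R; split=> // A mA.
- by rewrite -q1// -r1// qr1.
- by rewrite -q2// -r2// qr2.
Qed.

(** Cutting along the strip over A gives two pieces living on A and on its
complement, which are proportional only if one of them is zero. *)
Lemma extreme_zero_one mu nu :
  extreme_point (B L) (mu, nu) -> 0 < mu setT ->
  forall A, measurable A ->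
  (mu A = 0 \/ mu (~` A) = 0) /\ (nu A = 0 \/ nu (~` A) = 0).
Proof.
move=> ext mu0 A mA; have mAC := measurableC mA.
have [munuT tr] : mu setT = nu setT /\
    transport_le mu nu (1 - 2 * fine (mu setT)).
  have muc : mu setT = (fine (mu setT))%:E by rewrite fineK// fin_num_measure.
  have c0 : (0 < fine (mu setT))%R by rewrite -lte_fin -muc.
  by have [_ _ nuT tr] := (B_transportP L_gt0 nu c0 muc).1 ext.1; rewrite nuT.
(* E will be A x T for mu and T x A for nu *)
have main E : measurable E -> exists mu1 nu1 mu2 nu2 : {finite_measure set T -> \bar R},
    [/\ forall A, measurable A -> mu A = mu1 A + mu2 A /\ nu A = nu1 A + nu2 A,
      [\/ mu1 setT = 0 /\ nu1 setT = 0, mu2 setT = 0 /\ nu2 setT = 0 |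
       exists k1 k2 : R, [/\ (0 < k1)%R, (0 < k2)%R,
       forall A, measurable A -> k1%:E * mu1 A = k2%:E * mu2 A &
       forall A, measurable A -> k1%:E * nu1 A = k2%:E * nu2 A]] &
      forall A, measurable A ->
      [/\ (A `*` setT) `&` E = set0 -> mu1 A = 0,
          (A `*` setT) `&` ~` E = set0 -> mu2 A = 0,
          (setT `*` A) `&` E = set0 -> nu1 A = 0 &
          (setT `*` A) `&` ~` E = set0 -> nu2 A = 0]].
  move=> mE.
  have [mu1 [nu1 [mu2 [nu2 [s1 [s2 [dec [T1 T2] [tr1 tr2] s12 nullE]]]]]]] :=
    transport_split L_gt0 tr mE.
  exists mu1, nu1, mu2, nu2; split=> //.
  have [m10|m10] := eqVneq (mu1 setT) 0; first by constructor 1; rewrite -T1.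
  have [m20|m20] := eqVneq (mu2 setT) 0; first by constructor 2; rewrite -T2.
  constructor 3.
  have f1 : mu1 setT = (fine (mu1 setT))%:E by rewrite fineK// fin_num_measure.
  have f2 : mu2 setT = (fine (mu2 setT))%:E by rewrite fineK// fin_num_measure.
  have p1 : (0 < fine (mu1 setT))%R by rewrite -lte_fin -f1 lt0e m10/=.
  have p2 : (0 < fine (mu2 setT))%R by rewrite -lte_fin -f2 lt0e m20/=.
  have n1 : nu1 setT = (fine (mu1 setT))%:E by rewrite -T1.
  have n2 : nu2 setT = (fine (mu2 setT))%:E by rewrite -T2.
  apply: (extreme_split ext dec f1 n1 f2 n2 p1 p2 tr1 tr2).
  have := (dec _ measurableT).1; rewrite f1 f2 => /(congr1 fine)/= muT.
  by move: s12; rewrite muT; lra.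
have dich (m m1 m2 : {finite_measure set T -> \bar R}) :
    m A = m1 A + m2 A -> m (~` A) = m1 (~` A) + m2 (~` A) ->
    [\/ m1 setT = 0, m2 setT = 0 | exists k1 k2 : R, [/\ (0 < k1)%R, (0 < k2)%R &
       forall A, measurable A -> k1%:E * m1 A = k2%:E * m2 A]] ->
    m1 (~` A) = 0 -> m2 A = 0 -> m A = 0 \/ m (~` A) = 0.
  move=> mAE mACE H m1C m2A; rewrite mAE mACE m1C m2A adde0 add0e.
  have zero (n : {finite_measure set T -> \bar R}) D : measurable D -> n setT = 0 -> n D = 0.
    move=> mD n0; apply/eqP; rewrite eq_le measure_ge0 andbT -n0.
    by apply: le_measure => //; rewrite inE.
  case: H => [z|z|[k1 [k2 [k1p k2p kE]]]]; [by left; exact: zero|by right; exact: zero|].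
  left; have := kE A mA; rewrite m2A mule0 => /eqP.
  by rewrite mule_eq0 eqe gt_eqF//= => /eqP.
have XC (D : set T) : (D `*` [set: T]) `&` ~` (D `*` [set: T]) = set0 by rewrite setICr.
have XC' (D : set T) : ([set: T] `*` D) `&` ~` ([set: T] `*` D) = set0 by rewrite setICr.
split.
- have [mu1 [nu1 [mu2 [nu2 [dec tri nullE]]]]] := main _ (measurableX mA measurableT).
  apply: (dich mu mu1 mu2 (dec A mA).1 (dec _ mAC).1).
  + case: tri => [[? _]|[? _]|[k1 [k2 [? ? ? _]]]]; [by constructor 1|by constructor 2|].
    by constructor 3; exists k1, k2.
  + by have [+ _ _ _] := nullE _ mAC; apply; apply/seteqP; split => // -[x y] [[? _] [? _]].
  + by have [_ + _ _] := nullE _ mA; apply.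
- have [mu1 [nu1 [mu2 [nu2 [dec tri nullE]]]]] := main _ (measurableX measurableT mA).
  apply: (dich nu nu1 nu2 (dec A mA).2 (dec _ mAC).2).
  + case: tri => [[_ ?]|[_ ?]|[k1 [k2 [? ? _ ?]]]]; [by constructor 1|by constructor 2|].
    by constructor 3; exists k1, k2.
  + by have [_ _ + _] := nullE _ mAC; apply; apply/seteqP; split => // -[x y] [[_ ?] [_ ?]].
  + by have [_ _ _ +] := nullE _ mA; apply.
Qed.

Lemma null_cover mu (F : (set T)^nat) : 0 < mu setT ->
  (forall n, measurable (F n)) -> (forall n, mu (F n) = 0) ->
  exists x, forall n, ~ F n x.
Proof.
move=> mu0 mF F0; apply: contrapT => nx.
have cov : [set: T] `<=` \bigcup_n F n.
  move=> x _; apply: contrapT => xF; apply: nx; exists x => n Fx; apply: xF.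
  by exists n.
have := measure_sigma_subadditive mu mF measurableT cov.
rewrite eseries0; last by move=> n _ _; exact: F0.
by rewrite leNgt mu0.
Qed.

Lemma dirac_of_null mu (x : T) :
  (forall A, measurable A -> ~ A x -> mu A = 0) ->
  mu =m (fun A => (fine (mu setT))%:E * \d_x A).
Proof.
move=> H A mA; rewrite fineK ?fin_num_measure//.
have [Ax|Ax] := pselect (A x); last first.
  by rewrite H// diracE memNset// mule0.
have mAC := measurableC mA.
rewrite diracE mem_set// mule1 -(setvU A) measureU ?setICl//.
by rewrite [X in X + _]H ?add0e.
Qed.

(** In each fine partition some cell is conull. A point x common to conull sets
of diameter tending to 0 exists, and any conull set meets their intersection,
which is reduced to x. *)
Lemma zero_one_dirac mu : 0 < mu setT ->
  (forall A, measurable A -> mu A = 0 \/ mu (~` A) = 0) ->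
  exists x, mu =m (fun A => (fine (mu setT))%:E * \d_x A).
Proof.
move=> mu0 zo.
have cell (k : nat) : exists C : set T, [/\ measurable C, mu (~` C) = 0 &
    exists p, forall x, C x -> (mdist p x < k.+1%:R^-1)%R].
  have [|n [P [p [mP tP cP Pp]]]] := @torus_partition _ _ L_gt0 k.+1%:R^-1.
    by rewrite invr_gt0.
  suff [i Pi] : exists i, mu (~` P i) = 0.
    by exists (P i); split=> //; exists (p i) => x; exact: Pp.
  apply: contrapT => nP; move: mu0.
  rewrite (measure_finite_partition mu mP tP cP measurableT) big1 ?ltxx// => i _.
  rewrite setTI; have [//|z] := zo _ (mP i).
  by exfalso; apply: nP; exists i.
have [C CP] := choice cell.
have mC k : measurable (~` C k) by apply: measurableC; have [] := CP k.
have C0 k : mu (~` C k) = 0 by have [] := CP k.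
have [x xC] := null_cover mu0 mC C0.
exists x; apply: dirac_of_null => A mA Ax.
have [//|AC0] := zo _ mA; exfalso.
(* if A were conull, some y in A would lie in all the sets C k, as x does *)
pose F k := if k is k'.+1 then ~` C k' else ~` A.
have [|k|y yF] := @null_cover mu F mu0.
- by case=> [|k] /=; [exact: measurableC|exact: mC].
- by case: k => [|k] /=.
have Ay : A y by have := yF 0%N; rewrite /= /setC /= => /contrapT.
apply: Ax; suff -> : x = y by [].
apply: mdist_positivity; apply/eqP; rewrite eq_le mdist_ge0 andbT.
apply/ler_addgt0Pr => e e0; rewrite add0r.
have e2 : (0 < e / 2)%R by rewrite divr_gt0.
near \oo => k.
have [_ _ [p pC]] := CP k.
have Cx : C k x by have := xC k; rewrite /setC /= => /contrapT.
have Cy : C k y by have := yF k.+1; rewrite /= /setC /= => /contrapT.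
have ke : (k.+1%:R^-1 < e / 2)%R.
  by near: k; exact: near_infty_natSinv_lt (PosNum e2).
have := pC _ Cx; have := pC _ Cy; have := metric_triangle x p y.
rewrite (metric_sym x p); move: ke.
move: (k.+1%:R^-1)%R (mdist p x) (mdist p y) (mdist x y) => a b c d.
by lra.
Unshelve. all: by end_near.
Qed.

Lemma B_diracP mu nu (a : R) (x y : T) : (0 <= a)%R ->
  mu =m (fun A => a%:E * \d_x A) -> nu =m (fun A => a%:E * \d_y A) ->
  B L (mu, nu) <-> (a * (2 + mdist x y) <= 1)%R.
Proof.
move=> a0 muE nuE.
have muT : mu setT = a%:E by rewrite muE// diracT mule1.
have nuT : nu setT = a%:E by rewrite nuE// diracT mule1.
move: a0; rewrite le_eqVlt => /predU1P[a0|a0].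
  rewrite -a0 mul0r; split=> // _; split => /=.
  - exact: radon_dirac muE.
  - exact: radon_dirac nuE.
  - by rewrite /W1bar muT nuT -a0 eqxx !add0e.
  - by rewrite muT nuT.
have D := transport_le_dirac L_gt0 (1 - 2 * a) (ltW a0) muE nuE.
split.
  by move=> /(B_transportP L_gt0 nu a0 muT)[_ _ _ /D]; lra.
move=> H; apply/(B_transportP L_gt0 nu a0 muT); split=> //.
- exact: radon_dirac muE.
- exact: radon_dirac nuE.
by apply/D; lra.
Qed.

End extreme.

Section classification.
Context (R : realType) (L : R) (L_gt0 : (0 < L)%R).
Local Notation T := (torus L).
Implicit Types mu nu : {finite_measure set T -> \bar R}.

Lemma extreme_mzero mu nu : mu =m mzero -> nu =m mzero ->
  extreme_point (B L) (mu, nu).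
Proof.
move=> mu0 nu0; split.
  have z (m : {finite_measure set T -> \bar R}) : m =m mzero ->
      m =m (fun A => 0%:E * \d_(0%R : T) A).
    by move=> m0 A mA; rewrite m0// mul0e.
  by apply/(B_diracP L_gt0 _ (z _ mu0) (z _ nu0)) => //; rewrite mul0r.
move=> q r t _ _ /andP[t0 t1] /= mq nq.
have key (m1 m2 : {finite_measure set T -> \bar R}) A :
    0 = t%:E * m1 A + (1 - t)%:E * m2 A -> m1 A = m2 A.
  have h1 : 0 <= t%:E * m1 A by rewrite mule_ge0// lee_fin ltW.
  have h2 : 0 <= (1 - t)%:E * m2 A by rewrite mule_ge0// lee_fin subr_ge0 ltW.
  move=> /esym/eqP; rewrite padde_eq0//.
  have t1' : (0 < 1 - t)%R by rewrite subr_gt0.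
  by rewrite !mule_eq0 !eqe (gt_eqF t0) (gt_eqF t1')/= => /andP[/eqP-> /eqP->].
by split=> A mA; apply: key; [rewrite -mq ?mu0|rewrite -nq ?nu0].
Qed.

(** In a decomposition both pieces are multiples of the same Dirac masses, hence
of mass at most 1 / (2 + d). A weighted mean of two numbers equals a common
upper bound of them only if both do. *)
Lemma extreme_dirac mu nu (x y : T) :
  mu =m (fun A => ((2 + mdist x y)^-1)%:E * \d_x A) ->
  nu =m (fun A => ((2 + mdist x y)^-1)%:E * \d_y A) ->
  extreme_point (B L) (mu, nu).
Proof.
set d := mdist x y => muE nuE.
have d0 : (0 < 2 + d)%R by rewrite ltr_wpDr// mdist_ge0.
have k0 : (0 <= (2 + d)^-1)%R by rewrite invr_ge0 ltW.
split; first by apply/(B_diracP L_gt0 k0 muE nuE); rewrite mulVf// gt_eqF.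
move=> [q1 q2] [r1 r2] t Bq Br /andP[t0 t1] /= mq nq.
have t1' : (0 < 1 - t)%R by rewrite subr_gt0.
(* a component of a Dirac measure is a multiple of it *)
have conc (m m1 m2 : {finite_measure set T -> \bar R}) (z : T) :
    m =m (fun A => ((2 + d)^-1)%:E * \d_z A) ->
    m =m (fun A => t%:E * m1 A + (1 - t)%:E * m2 A) ->
    m1 =m (fun A => (fine (m1 setT))%:E * \d_z A) /\
    m2 =m (fun A => (fine (m2 setT))%:E * \d_z A).
  move=> mE mD.
  have H A : measurable A -> ~ A z -> m1 A = 0 /\ m2 A = 0.
    move=> mA Az; have /esym/eqP := mD A mA.
    rewrite mE// diracE memNset// mule0.
    have h1 : 0 <= t%:E * m1 A by rewrite mule_ge0// lee_fin ltW.
    have h2 : 0 <= (1 - t)%:E * m2 A by rewrite mule_ge0// lee_fin ltW.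
    rewrite padde_eq0//.
    by rewrite !mule_eq0 !eqe (gt_eqF t0) (gt_eqF t1')/= => /andP[/eqP-> /eqP->].
  by split; apply: dirac_of_null => A mA Az; have [] := H A mA Az.
have [q1E r1E] := conc _ _ _ _ muE mq; have [q2E r2E] := conc _ _ _ _ nuE nq.
have mass (p1 p2 : {finite_measure set T -> \bar R}) : B L (p1, p2) ->
    p1 =m (fun A => (fine (p1 setT))%:E * \d_x A) ->
    p2 =m (fun A => (fine (p2 setT))%:E * \d_y A) ->
    p2 setT = p1 setT /\ (fine (p1 setT) <= (2 + d)^-1)%R.
  move=> Bp p1E p2E; have [_ _ _ /= pT] := Bp; rewrite -pT in p2E *; split=> //.
  have p0 : (0 <= fine (p1 setT))%R by rewrite fine_ge0.
  by rewrite -[leRHS]mul1r ler_pdivlMr//; exact/(B_diracP L_gt0 p0 p1E p2E).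
have [qT qle] := mass _ _ Bq q1E q2E; have [rT rle] := mass _ _ Br r1E r2E.
have : ((2 + d)^-1 = t * fine (q1 setT) + (1 - t) * fine (r1 setT))%R.
  apply: EFin_inj; rewrite EFinD !EFinM !fineK ?fin_num_measure//.
  by rewrite -mq// muE// diracT mule1.
set k := (2 + d)^-1%R in qle rle *; move=> kE.
have qr : fine (q1 setT) = fine (r1 setT).
  have h1 : (0 <= t * (k - fine (q1 setT)))%R.
    by rewrite mulr_ge0 ?subr_ge0// ltW.
  have h2 : (0 <= (1 - t) * (k - fine (r1 setT)))%R.
    by rewrite mulr_ge0 ?subr_ge0// ltW.
  have h3 : (t * (k - fine (q1 setT)) = 0)%R by move: h1 h2; rewrite !mulrBr; lra.
  have h4 : ((1 - t) * (k - fine (r1 setT)) = 0)%R by move: h1 h2; rewrite !mulrBr; lra.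
  move: h3 h4 => /eqP + /eqP; rewrite !mulf_eq0 (gt_eqF t0) (gt_eqF t1')/= !subr_eq0.
  by move=> /eqP <- /eqP <-.
split=> A mA /=; first by rewrite q1E// r1E// qr.
by rewrite q2E// r2E// qT rT qr.
Qed.

Lemma extreme_classification mu nu : extreme_point (B L) (mu, nu) ->
  (mu =m mzero /\ nu =m mzero) \/
  (exists x y : T,
     mu =m (fun A => ((2 + mdist x y)^-1)%:E * \d_x A) /\
     nu =m (fun A => ((2 + mdist x y)^-1)%:E * \d_y A)).
Proof.
move=> ext; have [Bmn cvx] := ext; have [_ _ _ /= munuT] := Bmn.
have zero (m : {finite_measure set T -> \bar R}) : m setT = 0 -> m =m mzero.
  move=> m0 A mA; apply/eqP; rewrite eq_le measure_ge0 andbT.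
  by rewrite -[leRHS]/(0 : \bar R) -m0; apply: le_measure => //; rewrite inE.
have [mu0|mu0] := eqVneq (mu setT) 0.
  by left; split; apply: zero => //; rewrite -munuT.
right; have {}mu0 : 0 < mu setT by rewrite lt0e mu0/=.
have zo := extreme_zero_one L_gt0 ext mu0.
have [x muE] := zero_one_dirac L_gt0 mu0 (fun A mA => (zo A mA).1).
have nu0 : 0 < nu setT by rewrite -munuT.
have [y nuE] := zero_one_dirac L_gt0 nu0 (fun A mA => (zo A mA).2).
exists x, y; rewrite -munuT in nuE.
set c := fine (mu setT) in muE nuE.
have c0 : (0 < c)%R by rewrite fine_gt0// mu0/= ltey_eq fin_num_measure.
pose d := mdist x y.
have d0 : (0 < 2 + d)%R by rewrite ltr_wpDr// mdist_ge0.
have k0 : (0 <= (2 + d)^-1)%R by rewrite invr_ge0 ltW.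
suff cE : c = (2 + d)^-1%R by rewrite -/d -cE.
have := (B_diracP L_gt0 (ltW c0) muE nuE).1 Bmn; rewrite -/d.
rewrite le_eqVlt => /predU1P[c1|c1].
  by apply: (mulIf (lt0r_neq0 d0)); rewrite c1 mulVf// gt_eqF.
(* the pair would lie strictly between the origin and a larger pair *)
exfalso.
pose dm k (kp : (0 <= k)%R) (z : T) : {finite_measure set T -> \bar R} :=
  mscale (NngNum kp) (dirac z).
have dmE k kp z : @dm k kp z =m (fun A => k%:E * \d_z A) by [].
have z0 : (0 <= 0 :> R)%R by [].
have cdK : (c * (2 + d))%:E * ((2 + d)^-1)%:E = c%:E.
  by rewrite -EFinM mulfK// gt_eqF.
have [|||||q _] := cvx (dm _ k0 x, dm _ k0 y) (dm _ z0 x, dm _ z0 y) (c * (2 + d))%R.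
- by apply/(B_diracP L_gt0 k0 (dmE _ _ _) (dmE _ _ _)); rewrite mulVf// gt_eqF.
- by apply/(B_diracP L_gt0 z0 (dmE _ _ _) (dmE _ _ _)); rewrite mul0r.
- by rewrite c1 mulr_gt0.
- by move=> A mA /=; rewrite muE// !dmE// mul0e mule0 adde0 muleA cdK.
- by move=> A mA /=; rewrite nuE// !dmE// mul0e mule0 adde0 muleA cdK.
have := q setT measurableT; rewrite /= !dmE// !diracT !mule1 => -[] /eqP.
by rewrite invr_eq0 gt_eqF.
Qed.

End classification.

Unset Implicit Arguments.
Set Strict Implicit.

Theorem theorem6p18 (R : realType) (L : R) (L_gt0 : (0 < L)%R)
    (mu nu : {finite_measure set (torus L) -> \bar R}) :
  extreme_point (B L) (mu, nu) <->
  (mu =m mzero /\ nu =m mzero) \/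
  (exists x xbar : torus L,
     mu =m (fun A => ((2 + mdist x xbar)^-1)%:E * \d_x A) /\
     nu =m (fun A => ((2 + mdist x xbar)^-1)%:E * \d_xbar A)).
Proof.
split; first exact: extreme_classification.
move=> [[? ?]|[x [y [? ?]]]]; first exact: (extreme_mzero L_gt0).
exact: (@extreme_dirac R L L_gt0 mu nu x y).
Qed.
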